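(* Let $S$ be an infinite multiplicative subsemigroup of the positive integers. For $f\in L^1([0,1))$ let $$A_Nf(x)=\frac1{|S_N|}\sum_{n\in S_N}f(nx\bmod 1),\qquad S_N=\{n\in S: n\le N\}.$$ Then $A_Nf(x)$ converges to $\int_0^1 f$ for almost every $x$, for all $f\in L^1([0,1))$, if and only if $S$ is contained in a finitely generated multiplicative semigroup of positive integers.
   Context: $[0,1)$ carries Lebesgue measure. $A_Nf$ is considered for $N$ large enough that $S_N\ne\emptyset$. *)

(* Defs.v *)
From HB Require Import structures.
From mathcomp Require Import all_boot all_order all_algebra finmap.
From mathcomp Require Import all_classical all_reals all_analysis.

Set Implicit Arguments.
Unset Strict Implicit.
Unset Printing Implicit Defensive.

Import Order.TTheory GRing.Theory Num.Theory.
Import numFieldNormedType.Exports.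

Local Open Scope classical_set_scope.
Local Open Scope ring_scope.

Definition mul_closed (T : set nat) : Prop :=
  forall m n : nat, T m -> T n -> T (m * n)%N.

Definition pos_semigroup (T : set nat) : Prop :=
  T `<=` [set n : nat | (0 < n)%N] /\ mul_closed T.

(* No identity is adjoined: semigroups here need not contain 1. *)
Definition finitely_generated (T : set nat) : Prop :=
  exists2 G : set nat, finite_set G & T = smallest mul_closed G.

Definition trunc_set (S : set nat) (N : nat) : {fset nat} :=
  fset_set (S `&` [set n : nat | (n <= N)%N]).

Definition frac (R : realType) (x : R) : R := x - (Num.floor x)%:~R.

(* When S_N is empty this is 0; for infinite S only finitely many N are
   affected, so limits as N tends to infinity do not depend on it. *)
Definition dil_avg (R : realType) (S : set nat) (f : R -> R) (N : nat) (x : R)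
    : R :=
  (\sum_(n <- trunc_set S N) f (frac (n%:R * x))) / (#|` trunc_set S N|)%:R.

(* Main.v *)
Require Import Defs.
From HB Require Import structures.
From mathcomp Require Import all_boot all_order all_algebra finmap.
From mathcomp Require Import all_classical all_reals all_analysis measurable_realfun.
From mathcomp Require Import zify lra ring.

(** Write A_N f(x) for the average of f(nx mod 1) over S_N. The semigroup S
    lies in a finitely generated one exactly when the elements of S have only
    finitely many prime divisors ([finitely_generated_primes]), so the two
    implications are about finitely and infinitely many primes.

    Finitely many primes. Let d be the least number of primes whose valuations
    separate the points of S. By minimality, each of them can be varied without
    changing the others, and products of such variations show that |S_N| is at
    least a constant times (log N)^d; the d separating valuations bound by
    another constant times (log N)^d both |S_(N^2)| and the number of
    translates n' S_N that meet a given n S_N ([semigroup_doubling]). The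
    second bound is the hypothesis of a Vitali covering lemma on S
    ([vitali_semigroup]). Since x |-> nx mod 1 preserves Lebesgue measure,
    integrating the covering lemma over orbits gives a weak type (1,1)
    inequality for the maximal function of A_N |f| ([dil_maximal_inequality]),
    and it remains to check convergence on a dense class. That class consists
    of constants plus coboundaries g - g(q x) with q in S: their averages tend
    to 0 everywhere because the doubling of |S_N| makes S_N almost invariant
    under multiplication by q ([coboundary_avg]). It is dense because a mean
    zero function of the first digit in base q differs from such a coboundary
    by its average along successive digits, which is small in L^2 by
    independence of the digits ([birkhoff_square], [good_approx]).

    Infinitely many primes. For every I there is X such that |S_(X^i)| at least
    doubles at each of the steps i = 1, ..., I ([doubling_steps]). Choose d
    elements of S that are independent because each has a prime factor absent
    from the preceding ones, and sort S into classes modulo the group they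
    generate. If at every X some step failed to double, Pluennecke's inequality
    would bound the k-fold products of a class up to scale X^2 by 2^k times the
    size of a class at a scale polynomial in X, while the d independent
    elements alone make these products k^d times more numerous than a class at
    scale X. With d = k = 8(I+1) and iteration in X, class sizes would grow
    faster than the bound given by d valuations, a d-th power of a logarithm,
    allows.

    Hence half of S_(X^(i+1)) lies beyond X^i for i <= I. A function of an
    integer m that depends only on the integer part of log_X m modulo I and is
    the indicator of two adjacent residues therefore has, at every m with
    enough divisors, an average over some S_N of its values at m/n which is at
    least 1/2, although its mean is about 2/I ([tower_sets]). To transfer this
    to the circle, let the m-th level be the set of x with mx mod 1 in a
    suitable short interval: distinct levels m <= M are disjoint, and
    multiplication by n maps the level m into the level m/n ([tower_disjoint],
    [tower_pair]). Independent dilated copies enlarge the set of large averages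
    to measure at least 1/2 while the set whose indicator is averaged stays as
    small as wanted ([sweep]); summing 2^l times such indicators gives an
    integrable function with unbounded averages on a set of positive measure
    ([negative_direction]). *)

Set Implicit Arguments.
Unset Strict Implicit.
Unset Printing Implicit Defensive.

Import Order.TTheory GRing.Theory Num.Theory.
Import numFieldNormedType.Exports.

Local Open Scope classical_set_scope.
Local Open Scope ring_scope.

(** * Growth of semigroups with finitely many primes *)

Lemma trunc_setP (S : set nat) N n :
  reflect (S n /\ (n <= N)%N) (n \in trunc_set S N).
Proof.
rewrite /trunc_set in_fset_set; last first.
  apply: (@sub_finite_set _ _ `I_N.+1); last exact: finite_II.
  by move=> k [_ /=]; rewrite ltnS.
by apply: (iffP idP) => [/set_mem|?]; [|apply/mem_set].
Qed.

Lemma leq_card_inj (A B : {fset nat}) (f : nat -> nat) :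
  {in A &, injective f} -> (forall n, n \in A -> f n \in B) ->
  (#|` A| <= #|` B|)%N.
Proof.
move=> finj fAB.
have := @card_in_imfset imfset_key _ _ f _ finj => /= <-.
apply: fsubset_leq_card; apply/fsubsetP => _ /imfsetP[n /= nA ->].
exact: fAB.
Qed.

Lemma leq_card_fin (A : {fset nat}) (T : finType) (f : nat -> T) :
  {in A &, injective f} -> (#|` A| <= #|T|)%N.
Proof.
move=> finj.
have <- : size (map f A) = #|` A| by rewrite size_map.
have u : uniq (map f A) by rewrite map_inj_in_uniq ?fset_uniq.
by rewrite -(card_uniqP u) max_card.
Qed.

Lemma leq_card_of_fin (A : {fset nat}) (T : finType) (f : T -> nat) :
  injective f -> (forall t, f t \in A) -> (#|T| <= #|` A|)%N.
Proof.
move=> finj fA; rewrite cardT -(size_map f).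
apply: uniq_leq_size; first by rewrite map_inj_uniq // enum_uniq.
by move=> _ /mapP[t _ ->].
Qed.

Lemma count_coords (A : {fset nat}) d (w : 'I_d -> nat -> nat) l :
  (forall i (n : nat), n \in A -> (w i n <= l)%N) ->
  (forall m n : nat, m \in A -> n \in A -> (forall i, w i m = w i n) -> m = n) ->
  (#|` A| <= l.+1 ^ d)%N.
Proof.
move=> wl winj.
have := @leq_card_fin A {ffun 'I_d -> 'I_l.+1}
  (fun n => [ffun i => inord (w i n)]).
rewrite card_ffun !card_ord; apply=> m n mA nA /ffunP e.
apply: winj => // i; have := e i; rewrite !ffunE => /(congr1 val) /=.
by rewrite !inordK // ltnS wl.
Qed.

Lemma logn_leq_trunc_log p n N :
  (0 < n <= N)%N -> (logn p n <= trunc_log 2 N)%N.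
Proof.
move=> /andP[n0 nN]; have [pp|pn] := boolP (prime p); last first.
  by rewrite lognE (negbTE pn).
apply: trunc_log_max => //; apply: leq_trans nN.
apply: leq_trans (dvdn_leq n0 (pfactor_dvdnn p n)).
have [->//|e0] := posnP (logn p n).
by rewrite leq_exp2r // prime_gt1.
Qed.

Lemma logn_prod (I : Type) (r : seq I) p (F : I -> nat) :
  (forall i, (0 < F i)%N) ->
  logn p (\prod_(i <- r) F i) = (\sum_(i <- r) logn p (F i))%N.
Proof.
move=> F0; elim: r => [|i r IH]; first by rewrite !big_nil logn1.
by rewrite !big_cons lognM ?IH ?prodn_gt0.
Qed.

Definition primes_le (S : set nat) B :=
  forall n p, (S n -> prime p -> p %| n -> p <= B)%N.

Definition unbounded_primes (S : set nat) :=
  forall B, exists n p, [/\ S n, prime p, p %| n & B < p]%N.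

Definition separates (S : set nat) d (q : 'I_d -> nat) :=
  forall m n, S m -> S n -> (forall i, logn (q i) m = logn (q i) n) -> m = n.

(** Take d least: if no pair a, b of S differed at q i alone, then q i could be
    dropped from the family. Starting the search needs only that the primes up
    to B separate S. *)
Lemma separates_minimal S B : pos_semigroup S ->
  primes_le S B ->
  exists d (q : 'I_d -> nat), separates S q /\
    forall i, exists a b, [/\ S a, S b,
      forall j, j != i -> logn (q j) a = logn (q j) b &
      logn (q i) a <> logn (q i) b].
Proof.
move=> [Spos _] SB.
have exd : exists d, `[< exists q : 'I_d -> nat, separates S q >].
  (* the valuations at larger primes vanish on S *)
  exists B.+1; apply/asboolP; exists (fun i => val i) => m n Sm Sn e.
  apply: eqn_from_log; [exact: Spos|exact: Spos|move=> p].
  have [pB|Bp] := ltnP p B.+1; first exact: (e (Ordinal pB)).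
  have z k : S k -> logn p k = 0%N.
    move=> Sk; rewrite lognE; case: ifP => // /and3P[pp _ pk].
    by have := SB _ _ Sk pp pk; rewrite leqNgt Bp.
  by rewrite !z.
case: (ex_minnP exd) => d /asboolP[q qS] dmin.
exists d, q; split=> // i; apply: contrapT => H.
case: d => [|d] in q qS dmin i H *; first by case: i {H}.
have /dmin : `[< exists q : 'I_d -> nat, separates S q >].
  apply/asboolP; exists (fun j => q (lift i j)) => m n Sm Sn e.
  apply: contrapT => mn; apply: H; exists m, n; split=> //.
    move=> j; rewrite eq_sym => /unlift_some[k -> _]; exact: e.
  move=> ei; apply: mn; apply: qS => // j.
  have [->//|] := eqVneq j i.
  by rewrite eq_sym => /unlift_some[k -> _]; exact: e.
by rewrite ltnn.
Qed.

Lemma mul_closed_prodX S (I : Type) (r : seq I) (F : I -> nat) (e : I -> nat) x :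
  mul_closed S -> S x -> (forall i, S (F i)) ->
  S (x * \prod_(i <- r) F i ^ e i)%N.
Proof.
move=> SM Sx SF; elim: r x Sx => [|i r IH] x Sx; first by rewrite big_nil muln1.
rewrite big_cons mulnA; apply: IH.
elim: (e i) => [|k IHk]; first by rewrite muln1.
by rewrite expnSr mulnA; apply: SM.
Qed.

(** The left-hand side is B * M + x * (A - B) in the integers, an injective
    function of x. *)
Lemma weighted_mean_inj A B M x y : A <> B -> (x <= M)%N -> (y <= M)%N ->
  (x * A + (M - x) * B = y * A + (M - y) * B)%N -> x = y.
Proof.
move=> AB; wlog xy : x y / (x <= y)%N => [H xM yM e|].
  by case/orP: (leq_total x y) => h; [apply: H|apply/esym/H].
move=> xM yM; have [t yE] : exists t, y = (x + t)%N by exists (y - x)%N; lia.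
have -> : (M - x = M - y + t)%N by lia.
rewrite yE; case: t yE => [|t] _; first by move=> _; rewrite addn0.
rewrite !mulnDl => e; case: AB; apply/eqP.
rewrite -(@eqn_pmul2l t.+1) //; apply/eqP.
by move: e; move: (x * A)%N (_ * B)%N (_ * A)%N (_ * B)%N => *; lia.
Qed.

(** With a j, b j the pair that differs at q j only, the products n0 * prod_j
    (a j)^(i j) * (b j)^(M - i j), for exponents i j <= M, are pairwise
    distinct: their valuation at q k depends on i k alone, and injectively.
    They do not exceed n0 * W^M. *)
Lemma growth_lower S d (q : 'I_d -> nat) : pos_semigroup S ->
  (forall i, exists a b, [/\ S a, S b,
      forall j, j != i -> logn (q j) a = logn (q j) b &
      logn (q i) a <> logn (q i) b]) ->
  exists2 W, (1 < W)%N & forall n0 M, S n0 ->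
    (M.+1 ^ d <= #|` trunc_set S (n0 * W ^ M)|)%N.
Proof.
move=> [Spos SM] /choice[a] /choice[b] H.
have a0 i : (0 < a i)%N by have [/Spos] := H i.
have b0 i : (0 < b i)%N by have [_ /Spos] := H i.
pose W := (2 * \prod_i (a i * b i))%N.
have W0 : (0 < \prod_i (a i * b i))%N by rewrite prodn_gt0 // => i; rewrite muln_gt0 a0 b0.
exists W; first by rewrite /W; lia.
move=> n0 M Sn0.
pose E (i : {ffun 'I_d -> 'I_M.+1}) :=
  (n0 * \prod_j a j ^ i j * \prod_j b j ^ (M - i j))%N.
have -> : (M.+1 ^ d)%N = #|{ffun 'I_d -> 'I_M.+1}|.
  by rewrite card_ffun !card_ord.
apply: (@leq_card_of_fin _ _ E).
  have E1 (i : {ffun 'I_d -> 'I_M.+1}) k : logn (q k) (E i) = (logn (q k) n0 +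
      \sum_j (i j * logn (q k) (a j) + (M - i j) * logn (q k) (b j)))%N.
    have pa : (0 < \prod_j a j ^ i j)%N by apply: prodn_gt0 => j; rewrite expn_gt0 a0.
    have pb : (0 < \prod_j b j ^ (M - i j))%N by apply: prodn_gt0 => j; rewrite expn_gt0 b0.
    have n00 := Spos _ Sn0.
    rewrite /E lognM ?muln_gt0 ?n00 // lognM //.
    rewrite !logn_prod; [|by move=> j; rewrite expn_gt0 b0|by move=> j; rewrite expn_gt0 a0].
    by rewrite -addnA -big_split /=; congr addn; apply: eq_bigr => j _; rewrite !lognX.
  have E2 (i : {ffun 'I_d -> 'I_M.+1}) k : logn (q k) (E i) = (logn (q k) n0 +
      (i k * logn (q k) (a k) + (M - i k) * logn (q k) (b k) +
       \sum_(j < d | j != k) (M * logn (q k) (a j))))%N.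
    (* for j <> k the elements a j and b j agree at q k, so i j cancels *)
    rewrite E1 (bigD1 k) //=; congr (_ + (_ + _))%N; apply: eq_bigr => j jk.
    have [_ _ hj _] := H j; rewrite -(hj k) 1?eq_sym //.
    by rewrite -mulnDl subnKC // -ltnS.
  move=> i i' e; apply/ffunP => k; apply: val_inj => /=.
  have := congr1 (logn (q k)) e; rewrite !E2 => /addnI /addIn.
  by have [_ _ _ ne] := H k; apply: weighted_mean_inj; rewrite // -ltnS.
move=> i; apply/trunc_setP; split.
  apply: mul_closed_prodX => [//||j]; last by have [] := H j.
  by apply: mul_closed_prodX => [//|//|j]; have [] := H j.
rewrite /E -mulnA leq_mul // -big_split /=.
apply: leq_trans (_ : (\prod_j (a j * b j)) ^ M <= _)%N; last first.
  by have [->//|M0] := posnP M; rewrite leq_exp2r // /W leq_pmull.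
rewrite unstable.expn_prod; apply: leq_prod => j _.
by rewrite expnMn leq_mul // leq_pexp2l // ?leq_subr // -ltnS.
Qed.

(** All valuations of n' at the separating primes are within log_2 N of those
    of n, so each takes at most 2 log_2 N + 1 values. *)
Lemma ratio_count S d (q : 'I_d -> nat) N n (A : {fset nat}) :
  pos_semigroup S -> separates S q -> S n ->
  (forall n' : nat, n' \in A -> S n' /\ exists s s' : nat,
     [/\ s \in trunc_set S N, s' \in trunc_set S N & n' * s' = n * s]%N) ->
  (#|` A| <= (trunc_log 2 N).*2.+1 ^ d)%N.
Proof.
move=> [Spos SM] qS Sn HA; set l := trunc_log 2 N.
have key i n' : n' \in A -> (logn (q i) n <= logn (q i) n' + l)%N /\
                            (logn (q i) n' <= logn (q i) n + l)%N.
  case/HA => Sn' [s] [s'] [/trunc_setP[Ss sN] /trunc_setP[Ss' sN'] e].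
  have := congr1 (logn (q i)) e; rewrite !lognM ?Spos //.
  have : (logn (q i) s <= l)%N by apply: logn_leq_trunc_log; rewrite Spos.
  have : (logn (q i) s' <= l)%N by apply: logn_leq_trunc_log; rewrite Spos.
  lia.
apply: (@count_coords _ _ (fun i n' => logn (q i) n' + l - logn (q i) n)%N).
  by move=> i n' /(key i); lia.
move=> m m' mA mA' e; apply: qS; [by case/HA: mA|by case/HA: mA'|move=> i].
by have := e i; have := key i _ mA; have := key i _ mA'; lia.
Qed.

Lemma trunc_count S d (q : 'I_d -> nat) N :
  pos_semigroup S -> separates S q ->
  (#|` trunc_set S N| <= (trunc_log 2 N).+1 ^ d)%N.
Proof.
move=> [Spos _] qS; apply: (@count_coords _ _ (fun i n => logn (q i) n)).
  by move=> i n /trunc_setP[Sn nN]; apply: logn_leq_trunc_log; rewrite Spos.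
by move=> m n /trunc_setP[Sm _] /trunc_setP[Sn _]; apply: qS.
Qed.

(** Tempelman's condition |S_N S_N^-1| <= C |S_N| for averaging sets,
    restricted to the quotients that carry n to an element n' of S, that is to
    the translates n' S_N that meet n S_N. *)
Definition tempelman (S : set nat) C N :=
  forall n (A : {fset nat}), S n ->
    (forall n' : nat, n' \in A -> S n' /\ exists s s' : nat,
      [/\ s \in trunc_set S N, s' \in trunc_set S N & n' * s' = n * s]%N) ->
    (#|` A| <= C * #|` trunc_set S N|)%N.

(** Upper and lower bounds have the same exponent d, the least number of
    separating valuations, and the logarithms of N and N^2 are comparable. *)
Lemma semigroup_doubling S B : pos_semigroup S ->
  primes_le S B ->
  exists2 C, (0 < C)%N & forall N, (0 < #|` trunc_set S N|)%N ->
    (#|` trunc_set S (N ^ 2)| <= C * #|` trunc_set S N|)%N /\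
    tempelman S C N.
Proof.
move=> Ssg SB; have [d [q [qS qmin]]] := separates_minimal Ssg SB.
have [W W1 low] := growth_lower Ssg qmin.
have [Spos _] := Ssg.
have [Sex|noS] := pselect (exists n0, S n0); last first.
  exists 1%N => // N; rewrite cardfs_gt0 => /fset0Pn[n /trunc_setP[Sn _]].
  by case: noS; exists n.
have [n0 Sn0] := Sex; have n0_gt0 : (0 < n0)%N := Spos _ Sn0.
pose U := (n0 * W)%N; have U1 : (1 < U)%N by rewrite /U; nia.
pose w := (trunc_log 2 U).+1.
have Uw : (U < 2 ^ w)%N by rewrite trunc_log_ltn.
exists ((8 * w) ^ d)%N; first by rewrite expn_gt0 /w; lia.
move=> N N0.
have Npos : (0 < N)%N.
  move: N0; rewrite cardfs_gt0 => /fset0Pn[n /trunc_setP[Sn]]; exact/leq_trans/Spos.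
pose M := trunc_log U N.
have [UN NU] : (U ^ M <= N /\ N < U ^ M.+1)%N.
  by split; [exact: trunc_logP|exact: trunc_log_ltn].
(* the maximum covers the N below n0 * W, where M = 0 *)
have lowM : ((maxn M 1) ^ d <= #|` trunc_set S N|)%N.
  case: (posnP M) => [->|M0]; first by rewrite exp1n.
  have -> : maxn M 1 = M.-1.+1 by lia.
  apply: leq_trans (low n0 M.-1 Sn0) _; apply: fsubset_leq_card.
  apply/fsubsetP => n /trunc_setP[Sn nN]; apply/trunc_setP; split=> //.
  apply: leq_trans nN (leq_trans _ UN).
  rewrite /U expnMn leq_mul ?leq_pexp2l ?leq_pred // ?(ltnW W1) //.
  by rewrite -[leqLHS]expn1 leq_pexp2l // Spos.
have logN2 : (trunc_log 2 (N ^ 2) < 2 * (w * M.+1))%N.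
  rewrite -(@ltn_exp2l 2) //.
  apply: leq_ltn_trans (trunc_logP _ _) _ => //; first by rewrite expn_gt0 Npos.
  rewrite mulnC expnM ltn_exp2r //; apply: leq_trans NU _.
  by rewrite expnM leq_exp2r // ltnW.
have logN : (trunc_log 2 N < w * M.+1)%N.
  rewrite -(@ltn_exp2l 2) //.
  apply: leq_ltn_trans (trunc_logP _ _) _ => //.
  by apply: leq_trans NU _; rewrite expnM leq_exp2r // ltnW.
have fin x : (x <= 4 * (w * M.+1))%N ->
    (x ^ d <= (8 * w) ^ d * #|` trunc_set S N|)%N.
  move=> xle; apply: leq_trans (leq_mul (leqnn _) lowM).
  rewrite -expnMn; case: (d) => [//|d']; rewrite leq_exp2r //.
  apply: leq_trans xle _; rewrite /M; nia.
split; first by apply: leq_trans (trunc_count _ Ssg qS) (fin _ _); lia.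
move=> n A Sn HA; apply: leq_trans (ratio_count Ssg qS Sn HA) (fin _ _).
by lia.
Qed.

(** * Coboundaries and coverings in a semigroup *)

(** The elements of S_N that are not in s S: those at which the orbits of
    multiplication by s enter S_N. *)
Definition orbit_starts S s N : {fset nat} :=
  [fset n in trunc_set S N | ~~ `[< exists2 m, S m & n = (m * s)%N >] ]%fset.

(** The sets T * s^i, for i < log_s N, are disjoint and contained in S_(N^2).
    When |S_(N^2)| <= C |S_N|, it follows that T is a small part of S_N. *)
Lemma orbit_starts_count S s N : pos_semigroup S -> S s -> (1 < s)%N ->
  (#|` orbit_starts S s N| * trunc_log s N <= #|` trunc_set S (N ^ 2)|)%N.
Proof.
move=> [Spos SM] Ss s1; set T := orbit_starts S s N.
have TS n : n \in T -> S n /\ (n <= N)%N by rewrite !inE => /andP[/trunc_setP].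
pose M := trunc_log s N; rewrite -/M.
have [N0|N0] := posnP N.
  have -> : (#|` T| = 0)%N; last by [].
  apply/eqP; rewrite cardfs_eq0; apply/eqP/fsetP => n; rewrite inE.
  by apply/negbTE/negP => /TS[/Spos] /=; lia.
pose f (x : T * 'I_M) := (val x.1 * s ^ val x.2)%N.
have -> : (#|` T| * M)%N = #|{: T * 'I_M}|.
  by rewrite card_prod card_ord -cardfE.
have SX m i : S m -> S (m * s ^ i)%N.
  move=> Sm; elim: i => [|i IH]; first by rewrite muln1.
  by rewrite expnSr mulnA; apply: SM.
have finj (m n : nat) i j : m \in T -> n \in T -> (i <= j)%N ->
    (m * s ^ i = n * s ^ j)%N -> m = n /\ i = j.
  move=> mT nT ij; have [k ->] : exists k, j = (k + i)%N.
    by exists (j - i)%N; rewrite subnK.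
  rewrite expnD mulnA => /eqP.
  rewrite eqn_pmul2r ?expn_gt0 ?(ltnW s1) // => /eqP.
  case: k => [->|k e]; first by rewrite muln1 add0n.
  have [Sn _] := TS _ nT.
  move: mT; rewrite !inE => /andP[_ /asboolP[]].
  by exists (n * s ^ k)%N; [exact: SX|rewrite e expnSr mulnA].
apply: (@leq_card_of_fin _ _ f).
  move=> [m i] [n j]; rewrite /f /= => e.
  have [] : val m = val n /\ val i = val j.
    have [ij|/ltnW ij] := leqP i j; first exact: finj e.
    by have [] := finj _ _ _ _ (valP n) (valP m) ij (esym e).
  by move=> /val_inj -> /val_inj ->.
move=> [n i]; apply/trunc_setP; rewrite /f /=; have [Sn nN] := TS _ (valP n).
split; first exact: SX.
rewrite -mulnn leq_mul //; apply: leq_trans (trunc_logP s1 N0).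
by rewrite leq_exp2l // ltnW.
Qed.

(** The sum telescopes along orbits: what remains is a sum of g over S_N minus
    s S_N, which consists of orbit starts, and one over s S_N minus S_N, which
    has the same number of elements. *)
Lemma coboundary_sum (R : realType) S s N (g : nat -> R) (b : R) :
  pos_semigroup S -> S s -> (0 <= b) -> (forall n, `|g n| <= b) ->
  `|\sum_(n <- trunc_set S N) (g n - g (n * s)%N)| <=
    2 * b * #|` orbit_starts S s N|%:R.
Proof.
move=> [Spos SM] Ss b0 gb; have s0 := Spos _ Ss.
set A := trunc_set S N.
pose A' : {fset nat} := [fset (n * s)%N | n in A]%fset.
have minj : {in A &, injective (fun n => n * s)%N}.
  by move=> m n _ _ /eqP; rewrite eqn_pmul2r // => /eqP.
have cA' : #|` A'| = #|` A| by rewrite card_in_imfset.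
have sA' : \sum_(n <- A) g (n * s)%N = \sum_(n <- A') g n.
  by rewrite big_imfset.
have le (X : {fset nat}) : `|\sum_(n <- X) g n| <= b * #|` X|%:R.
  apply: le_trans (ler_norm_sum _ _ _) _.
  apply: le_trans (_ : \sum_(n <- X) b <= _); first exact: ler_sum.
  by rewrite big_const_seq count_predT iter_addr_0 mulr_natr.
have D1 : (#|` (A `\` A')%fset| <= #|` orbit_starts S s N|)%N.
  apply: fsubset_leq_card; apply/fsubsetP => n; rewrite !inE => /andP[nA' nA].
  rewrite nA /=; apply/asboolP => -[m Sm e]; move/negP: nA'; apply.
  apply/imfsetP; exists m => //=; apply/trunc_setP; split => //.
  have /trunc_setP[_] := nA; apply: leq_trans; rewrite e leq_pmulr //.
have D2 : (#|` (A' `\` A)%fset| <= #|` orbit_starts S s N|)%N.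
  apply: leq_trans D1.
  have := cardfsID A A'; have := cardfsID A' A; rewrite fsetIC; lia.
have dec (X Y : {fset nat}) : \sum_(n <- X) g n =
    \sum_(n <- (X `&` Y)%fset) g n + \sum_(n <- (X `\` Y)%fset) g n.
  rewrite (big_fsetID _ (mem Y)) /=; congr (_ + _); apply: eq_fbigl => n.
    by rewrite !inE.
  by rewrite !inE andbC.
rewrite sumrB sA' (dec A A') (dec A' A) fsetIC opprD addrACA subrr add0r.
apply: le_trans (ler_normB _ _) _.
have h (X : {fset nat}) : (#|` X| <= #|` orbit_starts S s N|)%N ->
   `|\sum_(n <- X) g n| <= b * #|` orbit_starts S s N|%:R.
  by move=> X1; apply: le_trans (le X) _; rewrite ler_wpM2l // ler_nat.
have := h _ D1; have := h _ D2.
set x := b * _; rewrite -mulrA -/x; lra.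
Qed.

Lemma seq_argmax (s : seq nat) (h : nat -> nat) : s != [::] ->
  exists2 x, x \in s & forall y, y \in s -> (h y <= h x)%N.
Proof.
elim: s => // a [|b s] IH _.
  by exists a; [exact: mem_head|move=> y; rewrite inE => /eqP ->].
have [//|x xs xm] := IH; have [ax|xa] := leqP (h a) (h x).
  exists x; first by rewrite inE xs orbT.
  by move=> y; rewrite inE => /orP[/eqP->//|/xm].
exists a; first exact: mem_head.
move=> y; rewrite inE => /orP[/eqP->//|/xm yx].
exact: leq_trans yx (ltnW xa).
Qed.

(** Greedy covering. Pick n in B with h n largest and discard the n' whose
    translate n' S_(h n') meets n S_(h n): by maximality of h n they satisfy n'
    s' = n s with both s and s' in S_(h n), so that Tempelman's condition
    bounds their number by C |S_(h n)|, which is paid for by the sum of phi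
    over n S_(h n). The remaining translates avoid this set, and induction
    applies to them with n S_(h n) removed from U. *)
Lemma vitali_semigroup (R : realType) (S : set nat) C (phi : nat -> R) (h : nat -> nat)
    (lam : R) (B U : {fset nat}) :
  pos_semigroup S -> (forall n, 0 <= phi n) -> 0 <= lam ->
  (forall n : nat, n \in B -> [/\ S n, (0 < #|` trunc_set S (h n)|)%N,
     lam * #|` trunc_set S (h n)|%:R <=
       \sum_(s <- trunc_set S (h n)) phi (n * s)%N &
     forall s : nat, s \in trunc_set S (h n) -> (n * s)%N \in U]) ->
  (forall N, (0 < #|` trunc_set S N|)%N -> tempelman S C N) ->
  lam * #|` B|%:R <= C%:R * \sum_(t <- U) phi t.
Proof.
move=> [Spos SM] phi0 lam0 HB HC.
have [k] := ubnP #|` B|; elim: k => // k IH in B U HB *; rewrite ltnS => Bk.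
have [->|] := eqVneq B fset0.
  by rewrite cardfs0 mulr0 mulr_ge0 // sumr_ge0.
move=> /fset0Pn[n' n'B]; have B0 : (enum_fset B != [::]).
  by apply/eqP => e; move: n'B; rewrite -[_ \in B]/(_ \in enum_fset B) e.
have [n nB nmax] := seq_argmax h B0 => {n' n'B}.
have [Sn hn0 hlam hU] := HB n nB; set A := trunc_set S (h n).
pose P (n' : nat) := `[< exists s s' : nat,
   [/\ s \in A, s' \in trunc_set S (h n') & n' * s' = n * s]%N >].
pose B0' := [fset x in B | P x]%fset; pose B1 := [fset x in B | ~~ P x]%fset.
pose U0 : {fset nat} := [fset (n * s)%N | s in A]%fset.
have n0 := Spos _ Sn.
have cB : #|` B| = (#|` B0'| + #|` B1|)%N.
  rewrite /B0' /B1 !card_fset_sum1 (big_fsetID _ P) //.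
have nB0 : n \in B0'.
  rewrite !inE /= nB /=; apply/asboolP.
  by move: hn0; rewrite cardfs_gt0 => /fset0Pn[s sA]; exists s, s.
have mono n' : n' \in B -> (trunc_set S (h n') `<=` A)%fset.
  move=> n'B; apply/fsubsetP => s /trunc_setP[Ss sn']; apply/trunc_setP; split=> //.
  exact: leq_trans sn' (nmax _ n'B).
have c0 : (#|` B0'| <= C * #|` A|)%N.
  apply: (HC _ hn0 _ _ Sn) => n'; rewrite !inE => /andP[n'B /asboolP[s [s' [sA s'A e]]]].
  split; first by have [] := HB n' n'B.
  by exists s, s'; split=> //; exact: (fsubsetP (mono _ n'B)).
have IH1 : lam * #|` B1|%:R <= C%:R * \sum_(t <- (U `\` U0)%fset) phi t.
  apply: IH.
    move=> n'; rewrite !inE /= => /andP[n'B nP].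
    have [Sn' hn'0 hlam' hU'] := HB n' n'B; split=> // s sA.
    rewrite !inE hU' // andbT; apply/negP => /imfsetP[s1 /= s1A e].
    by move/asboolP: nP; apply; exists s1, s.
  apply: leq_trans Bk; rewrite cB -[ltnLHS]add0n ltn_add2r cardfs_gt0.
  by apply/fset0Pn; exists n.
have U0U : (U0 `<=` U)%fset.
  by apply/fsubsetP => _ /imfsetP[s /= sA ->]; exact: hU.
have sU : \sum_(t <- U) phi t = \sum_(s <- A) phi (n * s)%N +
    \sum_(t <- (U `\` U0)%fset) phi t.
  rewrite (big_fsetID _ (mem U0)) /=; congr (_ + _); last first.
    by apply: eq_fbigl => t; rewrite !inE andbC.
  have -> : \sum_(s <- A) phi (n * s)%N = \sum_(t <- U0) phi t.
    rewrite big_imfset //= => x y _ _ /eqP.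
    by rewrite eqn_pmul2l // => /eqP.
  apply: eq_fbigl => t; rewrite !inE /=.
  by apply/andP/idP => [[]//|tU0]; split=> //; exact: (fsubsetP U0U).
rewrite cB natrD mulrDr sU mulrDr lerD //.
apply: le_trans (ler_wpM2l (ler0n R C) hlam).
by rewrite mulrCA ler_wpM2l // -natrM ler_nat.
Qed.

(** * Product sets and Pluennecke's inequality *)

Definition prodfs (A B : {fset nat}) : {fset nat} :=
  [fset (x * y)%N | x in A, y in B]%fset.

Lemma prodfsP (A B : {fset nat}) (n : nat) :
  reflect (exists x y : nat, [/\ x \in A, y \in B & n = x * y]%N) (n \in prodfs A B).
Proof.
apply: (iffP idP) => [/imfset2P[x /= xA [y /= yB ->]]|[x [y [xA yB ->]]]].
  by exists x, y.
by apply/imfset2P; exists x => //; exists y.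
Qed.

Lemma mem_prodfs (A B : {fset nat}) (x y : nat) :
  x \in A -> y \in B -> (x * y)%N \in prodfs A B.
Proof. by move=> xA yB; apply/prodfsP; exists x, y. Qed.

Lemma prodfsA A B C : prodfs A (prodfs B C) = prodfs (prodfs A B) C.
Proof.
apply/fsetP => n; apply/prodfsP/prodfsP.
  move=> [x [_ [xA /prodfsP[y [z [yB zC ->]]] ->]]].
  by exists (x * y)%N, z; split=> //; [exact: mem_prodfs|rewrite mulnA].
move=> [_ [z [/prodfsP[x [y [xA yB ->]]] zC ->]]].
by exists x, (y * z)%N; split=> //; [exact: mem_prodfs|rewrite mulnA].
Qed.

Lemma card_fset_mulr (A : {fset nat}) c : (0 < c)%N ->
  #|` [fset (x * c)%N | x in A]%fset| = #|` A|.
Proof.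
move=> c0; rewrite card_imfset //.
by move=> m n /eqP; rewrite eqn_pmul2r // => /eqP.
Qed.

(** Petridis's lemma, by adding the elements c of C one at a time. Let Y be the
    part of X with Y c inside X C', where C' is C without c. Then X C gains at
    least |X| - |Y| elements over X C', while X D C gains at most |X D| - |Y
    D|, because Y D c already lies in X D C'. The minimality of |X D| / |X|
    among subsets of X compares the two gains. *)
Lemma petridis (X D C : {fset nat}) :
  (forall c : nat, c \in C -> (0 < c)%N) ->
  (forall Y, (Y `<=` X)%fset ->
    (#|` prodfs X D| * #|` Y| <= #|` prodfs Y D| * #|` X|)%N) ->
  (#|` prodfs (prodfs X D) C| * #|` X| <= #|` prodfs X D| * #|` prodfs X C|)%N.
Proof.
move=> C0 HX; have [k] := ubnP #|` C|; elim: k => // k IH in C C0 *.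
rewrite ltnS => Ck; have [->|] := eqVneq C fset0.
  have -> : prodfs (prodfs X D) fset0 = fset0.
    by apply/fsetP => n; rewrite inE; apply/negbTE/prodfsP => -[x [y []]].
  by rewrite cardfs0.
move=> /fset0Pn[c cC]; have c0 := C0 _ cC.
pose C' := (C `\ c)%fset.
have cinj (Z : {fset nat}) : {in Z &, injective (fun n => n * c)%N}.
  by move=> m n _ _ /eqP; rewrite eqn_pmul2r // => /eqP.
have IHC : (#|` prodfs (prodfs X D) C'| * #|` X| <=
            #|` prodfs X D| * #|` prodfs X C'|)%N.
  apply: IH => [n|]; first by rewrite !inE => /andP[_ /C0].
  by apply: leq_trans Ck; rewrite (cardfsD1 c C) cC.
pose Y := [fset x in X | (x * c)%N \in prodfs X C']%fset.
have YX : (Y `<=` X)%fset by apply/fsubsetP => n; rewrite !inE => /andP[].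
have CE (y : nat) : y \in C -> y = c \/ y \in C'.
  by move=> yC; rewrite !inE yC andbT; case: eqVneq; [left|right].
have e1 : (#|` prodfs X C'| + #|` (X `\` Y)%fset| <= #|` prodfs X C|)%N.
  pose Z : {fset nat} := [fset (x * c)%N | x in (X `\` Y)%fset]%fset.
  have -> : #|` (X `\` Y)%fset| = #|` Z| by rewrite card_fset_mulr.
  have dis : (prodfs X C' `&` Z)%fset = fset0.
    apply/fsetP => n; rewrite !inE; apply/negbTE/negP => /andP[nX].
    move=> /imfsetP[x /=]; rewrite !inE => /andP[xY xX] e.
    by move/negP: xY; apply; rewrite xX -e.
  have := cardfsUI (prodfs X C') Z; rewrite dis cardfs0 addn0 => <-.
  apply: fsubset_leq_card; apply/fsubsetP => n; rewrite inE => /orP[].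
    move=> /prodfsP[x [y [xX]]]; rewrite !inE => /andP[_ yC] ->.
    exact: mem_prodfs.
  move=> /imfsetP[x /=]; rewrite !inE => /andP[_ xX] ->; exact: mem_prodfs.
have e2 : (#|` prodfs (prodfs X D) C| <=
    #|` prodfs (prodfs X D) C'| + #|` (prodfs X D `\` prodfs Y D)%fset|)%N.
  pose Z : {fset nat} := [fset (x * c)%N | x in (prodfs X D `\` prodfs Y D)%fset]%fset.
  have -> : #|` (prodfs X D `\` prodfs Y D)%fset| = #|` Z| by rewrite card_fset_mulr.
  rewrite -cardfsUI; apply: leq_trans (leq_addr _ _).
  apply: fsubset_leq_card; apply/fsubsetP => n /prodfsP[z [y [zXD yC ->]]].
  rewrite inE; have [->|yC'] := CE _ yC; last by rewrite mem_prodfs.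
  apply/orP; have [zYD|zYD] := boolP (z \in prodfs Y D); [left|right]; last first.
    by apply/imfsetP; exists z => //=; rewrite !inE zYD.
  have /prodfsP[x [t [+ tD ->]]] := zYD.
  rewrite !inE => /andP[xX /prodfsP[x' [y' [x'X y'C' e]]]].
  by rewrite mulnAC e mulnAC mem_prodfs // mem_prodfs.
have YD : (prodfs Y D `<=` prodfs X D)%fset.
  apply/fsubsetP => n /prodfsP[x [y [xY yD ->]]].
  by apply: mem_prodfs => //; exact: (fsubsetP YX).
rewrite cardfsDS // in e1; rewrite cardfsDS // in e2.
have hY := HX _ YX.
have := fsubset_leq_card YX; have := fsubset_leq_card YD.
move: e1 e2 hY IHC.
move: #|` prodfs X C'| #|` prodfs X C| #|` prodfs (prodfs X D) C| #|` prodfs (prodfs X D) C'|.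
move: #|` X| #|` Y| #|` prodfs X D| #|` prodfs Y D| => x y xd yd xc' xc xdc xdc'.
move=> e1 e2 hY IHC ydxd yx.
have : (xdc * x <= (xdc' + (xd - yd)) * x)%N by rewrite leq_mul2r e2 orbT.
have : (xd * (xc' + (x - y)) <= xd * xc)%N by rewrite leq_mul2l e1 orbT.
rewrite !mulnDl !mulnDr mulnBr mulnBl; lia.
Qed.

Lemma seq_argmin_rat (T : eqType) (s : seq T) (h : T -> rat) : s != [::] ->
  exists2 x, x \in s & forall y, y \in s -> h x <= h y.
Proof.
elim: s => // a [|b s] IH _.
  by exists a; [exact: mem_head|move=> y; rewrite inE => /eqP ->].
have [//|x xs xm] := IH; have [ax|xa] := leP (h x) (h a).
  exists x; first by rewrite inE xs orbT.
  by move=> y; rewrite inE => /orP[/eqP->//|/xm].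
exists a; first exact: mem_head.
move=> y; rewrite inE => /orP[/eqP->//|/xm yx].
exact: le_trans (ltW xa) yx.
Qed.

Fixpoint prodfs_exp (D : {fset nat}) j : {fset nat} :=
  if j is j'.+1 then prodfs D (prodfs_exp D j') else [fset 1%N]%fset.

(** Choose the nonempty X inside A with |X D| / |X| least; the ratio is then at
    most K, and Petridis's lemma with C = D^j gives |X D^(j+1)| <= K |X D^j|.
    Finally D^k embeds into X D^k. *)
Lemma plunnecke (A D : {fset nat}) K k :
  (forall n : nat, n \in A -> (0 < n)%N) ->
  (forall n : nat, n \in D -> (0 < n)%N) ->
  A != fset0 -> (#|` prodfs A D| <= K * #|` A|)%N ->
  (#|` prodfs_exp D k| <= K ^ k * #|` A|)%N.
Proof.
move=> A0 D0 An AD.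
pose P := [seq X <- enum_fset (fpowerset A) | X != fset0].
have memP (Y : {fset nat}) : (Y \in P) = (Y != fset0) && (Y `<=` A)%fset.
  by rewrite mem_filter; congr andb; exact: fpowersetE.
have [|X] := @seq_argmin_rat _ P (fun X => #|` prodfs X D|%:R / #|` X|%:R).
  by apply/eqP => e; have := memP A; rewrite An fsubset_refl e.
rewrite memP => /andP[Xn XA] Xmin.
have Xmin' Y : (Y `<=` A)%fset ->
    (#|` prodfs X D| * #|` Y| <= #|` prodfs Y D| * #|` X|)%N.
  move=> YA; have [->|Yn] := eqVneq Y fset0; first by rewrite cardfs0 muln0.
  have : #|` prodfs X D|%:R / #|` X|%:R <= #|` prodfs Y D|%:R / #|` Y|%:R :> rat.
    by apply: Xmin; rewrite memP Yn.
  by rewrite ler_pdivrMr ?ltr0n ?cardfs_gt0 // mulrAC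
     ler_pdivlMr ?ltr0n ?cardfs_gt0 // -!natrM ler_nat.
have XK : (#|` prodfs X D| <= K * #|` X|)%N.
  have := Xmin' _ (fsubset_refl A); rewrite -cardfs_gt0 in An.
  move=> h; rewrite -(@leq_pmul2r #|` A|) //; apply: leq_trans h _.
  by rewrite mulnAC leq_mul2r AD orbT.
have pw0 j (n : nat) : n \in prodfs_exp D j -> (0 < n)%N.
  elim: j n => [|j IH] n /=; first by rewrite inE => /eqP ->.
  by move=> /prodfsP[x [y [/D0 x0 /IH y0 ->]]]; rewrite muln_gt0 x0.
have XP j : (#|` prodfs X (prodfs_exp D j)| <= K ^ j * #|` X|)%N.
  elim: j => [|j IH] /=.
    rewrite mul1n -(card_fset_mulr X (ltn0Sn 0)).
    apply: fsubset_leq_card; apply/fsubsetP => n /prodfsP[x [y [xX]]].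
    by rewrite inE => /eqP -> ->; apply/imfsetP; exists x.
  rewrite prodfsA.
  have := @petridis X D (prodfs_exp D j) (pw0 j).
  move=> /(_ (fun Y YX => Xmin' Y (fsubset_trans YX XA))) h.
  rewrite -cardfs_gt0 in Xn.
  rewrite -(@leq_pmul2r #|` X|) //; apply: leq_trans h _.
  apply: leq_trans (leq_mul XK IH) _.
  by rewrite expnS mulnACA -!mulnA leqnn.
apply: leq_trans (_ : _ <= #|` prodfs X (prodfs_exp D k)|)%N _; last first.
  by apply: leq_trans (XP k) _; rewrite leq_mul2l fsubset_leq_card // orbT.
move: Xn => /fset0Pn[x xX]; have x0 : (0 < x)%N by apply: A0; exact: (fsubsetP XA).
apply: (@leq_card_inj _ _ (fun n => x * n)%N).
  by move=> m n _ _ /eqP; rewrite eqn_pmul2l // => /eqP.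
by move=> n nP; exact: mem_prodfs.
Qed.

(** * Classes modulo independent elements *)

(** A prime larger than all the s j already chosen divides none of them. *)
Lemma triangular_family S d : pos_semigroup S ->
  unbounded_primes S ->
  exists s p : nat -> nat, forall i, (i < d)%N ->
    [/\ S (s i), prime (p i), (p i %| s i)%N &
      forall j, (j < i)%N -> ~~ (p i %| s j)%N].
Proof.
move=> [Spos _] Sinf; elim: d => [|d [s [p IH]]].
  by exists id, id.
have [n [q [Sn pq qn Bq]]] := Sinf (\max_(j < d) s j)%N.
exists (fun i => if i == d then n else s i), (fun i => if i == d then q else p i).
move=> i; rewrite ltnS leq_eqVlt => /predU1P[->|id].
  rewrite eqxx; split=> // j jd; rewrite (ltn_eqF jd).
  apply/negP => /dvdn_leq; have [/Spos s0 _ _ _] := IH _ jd.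
  move=> /(_ s0); apply/negP; rewrite -ltnNge; apply: leq_ltn_trans Bq.
  exact: (leq_bigmax (Ordinal jd)).
rewrite (ltn_eqF id); have [? ? ? H] := IH _ id; split=> // j ji.
by rewrite (ltn_eqF (ltn_trans ji id)) H.
Qed.

Section classes.
Variables (S : set nat) (d : nat) (s p : 'I_d -> nat).
Hypothesis Ssg : pos_semigroup S.
Hypothesis Ss : forall i, S (s i).
Hypothesis pp : forall i, prime (p i).
Hypothesis ps : forall i, (p i %| s i)%N.
Hypothesis pns : forall i j : 'I_d, (j < i)%N -> ~~ (p i %| s j)%N.

Let s0 i : (0 < s i)%N. Proof. by case: Ssg => Spos _; exact: Spos. Qed.

Definition monomial (c : 'I_d -> nat) := (\prod_i s i ^ c i)%N.

Lemma monomial_gt0 c : (0 < monomial c)%N.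
Proof. by apply: prodn_gt0 => i; rewrite expn_gt0 s0. Qed.

Lemma monomialD c c' : monomial (fun i => c i + c' i)%N = (monomial c * monomial c')%N.
Proof.
by rewrite /monomial -big_split /=; apply: eq_bigr => i _; rewrite expnD.
Qed.

Lemma monomialX c k : monomial (fun i => k * c i)%N = (monomial c ^ k)%N.
Proof.
rewrite /monomial unstable.expn_prod; apply: eq_bigr => i _.
by rewrite mulnC expnM.
Qed.

Lemma eq_monomial c c' : c =1 c' -> monomial c = monomial c'.
Proof. by move=> e; apply: eq_bigr => i _; rewrite e. Qed.

Lemma logn_monomial c i : logn (p i) (monomial c) =
  (\sum_(j < d | (i <= j)%N) c j * logn (p i) (s j))%N.
Proof.
rewrite /monomial logn_prod; last by move=> j; rewrite expn_gt0 s0.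
rewrite [RHS]big_mkcond /=; apply: eq_bigr => j _; rewrite lognX.
case: leqP => // ji; suff -> : logn (p i) (s j) = 0%N by rewrite muln0.
by rewrite lognE (negbTE (pns ji)) !andbF.
Qed.

(** The matrix of the valuations of the s j at the p i is triangular with
    nonzero diagonal entries, so the exponents are recovered from the last one
    down. *)
Lemma monomial_separated c c' :
  (forall i, logn (p i) (monomial c) = logn (p i) (monomial c')) -> c =1 c'.
Proof.
move=> e i; have [k] := ubnP (d - i); elim: k => // k IH in i *.
rewrite ltnS => ik; have := e i; rewrite !logn_monomial.
rewrite (bigD1 i) //= [RHS](bigD1 i) //=.
rewrite (_ : \sum_(j < d | (i <= j)%N && (j != i)) c j * logn (p i) (s j) =
  \sum_(j < d | (i <= j)%N && (j != i)) c' j * logn (p i) (s j))%N; last first.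
  apply: eq_bigr => j /andP[ij ji]; rewrite IH //.
  have : (i < j)%N by rewrite ltn_neqAle eq_sym (inj_eq val_inj) ji.
  by move: ik (ltn_ord j) (ltn_ord i); lia.
move=> /addIn /eqP; rewrite eqn_pmul2r ?logn_gt0 ?mem_primes ?pp ?s0 ?ps //.
by move=> /eqP.
Qed.

Lemma monomial_inj c c' : monomial c = monomial c' -> c =1 c'.
Proof. by move=> e; apply: monomial_separated => i; rewrite e. Qed.

(** Equality modulo the group generated by the s i; monomials multiply both
    sides so that exponents of either sign are reached within the natural
    numbers. *)
Definition eqv m n := exists c c', (m * monomial c = n * monomial c')%N.

Lemma eqv_refl n : eqv n n.
Proof. by exists (fun=> 0%N), (fun=> 0%N). Qed.

Lemma eqv_sym m n : eqv m n -> eqv n m.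
Proof. by move=> [c [c' e]]; exists c', c. Qed.

Lemma eqv_trans m n r : eqv m n -> eqv n r -> eqv m r.
Proof.
move=> [c [c' e]] [b [b' e']].
exists (fun i => c i + b i)%N, (fun i => b' i + c' i)%N.
by rewrite !monomialD !mulnA e mulnAC e'.
Qed.

Lemma eqv_mul2l r m n : eqv m n -> eqv (r * m) (r * n).
Proof. by move=> [c [c' e]]; exists c, c'; rewrite -!mulnA e. Qed.

Lemma eqv_mulr2 r m n : (0 < r)%N -> eqv (m * r) (n * r) -> eqv m n.
Proof.
move=> r0 [c [c' e]]; exists c, c'; apply/eqP.
by rewrite -(eqn_pmul2r r0) mulnAC e mulnAC.
Qed.

Lemma eqv_mul_monomial n c : eqv n (n * monomial c).
Proof. by exists c, (fun=> 0%N); rewrite -mulnA -monomialD; congr muln; apply: eq_monomial => i; rewrite addn0. Qed.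

(** Two elements of a class differ by monomials, which the valuations at the p
    i separate. *)
Lemma eqv_logn m n : eqv m n -> (0 < m)%N -> (0 < n)%N ->
  (forall i, logn (p i) m = logn (p i) n) -> m = n.
Proof.
move=> [c [c' e]] m0 n0 el.
have : c =1 c'.
  apply: monomial_separated => i; have := congr1 (logn (p i)) e.
  by rewrite !lognM ?monomial_gt0 // el => /addnI.
move=> /eq_monomial cc; move/eqP: e; rewrite cc eqn_pmul2r ?monomial_gt0 //.
by move/eqP.
Qed.

(** Within a class, m and n differ by an exponent vector c' - c, and the
    hypothesis reads k (c' - c) = b - a; the entries of a and b are smaller
    than k, so reduction modulo k gives a = b, and then c = c'. *)
Lemma eqv_expn_inj m n k (a b : 'I_d -> nat) : (0 < m)%N -> eqv m n ->
  (forall i, (a i < k)%N) -> (forall i, (b i < k)%N) ->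
  (m ^ k * monomial a = n ^ k * monomial b)%N -> m = n /\ a =1 b.
Proof.
move=> m0 [c [c' e]] ak bk E.
have k0 : forall i : 'I_d, (0 < k)%N by move=> i; apply: leq_ltn_trans (ak i).
have : monomial (fun i => k * c' i + a i)%N = monomial (fun i => k * c i + b i)%N.
  rewrite !monomialD !monomialX; apply/eqP.
  have n0 : (0 < n)%N.
    by have := monomial_gt0 c; rewrite -(ltn_pmul2l m0) muln0 e muln_gt0 => /andP[].
  have mn0 : (0 < m ^ k * n ^ k)%N by rewrite muln_gt0 !expn_gt0 m0 n0.
  have ek : (m ^ k * monomial c ^ k = n ^ k * monomial c' ^ k)%N by rewrite -!expnMn e.
  by rewrite -(eqn_pmul2l mn0) [eqbRHS]mulnACA ek [(m ^ k * _)%N]mulnC mulnACA E.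
move=> /monomial_inj cab.
have ab : a =1 b.
  move=> i; have := congr1 (modn^~ k) (cab i).
  by rewrite /= ![(k * _)%N]mulnC !modnMDl !modn_small.
have cc : c =1 c'.
  move=> i; have := cab i; rewrite ab => /addIn /eqP.
  by rewrite eqn_pmul2l ?(k0 i) // => /eqP.
split=> //; move/eqP: e; rewrite (eq_monomial cc) eqn_pmul2r ?monomial_gt0 //.
by move/eqP.
Qed.

Definition eqv_class (A : {fset nat}) (a : nat) : {fset nat} :=
  [fset x in A | `[< eqv a x >]]%fset.

Definition eqv_ball N (n0 : nat) : {fset nat} := eqv_class (trunc_set S N) n0.

Lemma eqv_ballP N (n0 n : nat) :
  reflect [/\ S n, (n <= N)%N & eqv n0 n] (n \in eqv_ball N n0).
Proof.
rewrite !inE /=; apply: (iffP andP) => [[/trunc_setP[? ?] /asboolP]|[Sn nN e]] //.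
by split; [exact/trunc_setP|exact/asboolP].
Qed.

Definition max_class_size N := (\max_(n <- trunc_set S N) #|` eqv_ball N n|)%N.

Lemma leq_max_class_size M N : (M <= N)%N -> (max_class_size M <= max_class_size N)%N.
Proof.
move=> MN; apply/bigmax_leqP_seq => n nM _.
have nN : n \in trunc_set S N.
  by case/trunc_setP: nM => Sn nM; apply/trunc_setP; split=> //; exact: leq_trans MN.
apply: leq_trans (@leq_bigmax_seq _ _ _ (fun n => #|` eqv_ball N n|) _ nN isT).
apply: fsubset_leq_card; apply/fsubsetP => x /eqv_ballP[Sx xM e]; apply/eqv_ballP.
by split=> //; exact: leq_trans MN.
Qed.

(** On a class the d valuations at the p i are injective, and each is at most
    log_2 N. *)
Lemma max_class_size_bound N : (max_class_size N <= (trunc_log 2 N).+1 ^ d)%N.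
Proof.
have [Spos _] := Ssg.
apply/bigmax_leqP_seq => n nM _.
apply: (@count_coords _ _ (fun i n => logn (p i) n)).
  by move=> i x /eqv_ballP[Sx xN _]; apply: logn_leq_trunc_log; rewrite Spos.
move=> x y /eqv_ballP[/Spos x0 _ ex] /eqv_ballP[/Spos y0 _ ey]; apply: eqv_logn => //.
exact: eqv_trans (eqv_sym ex) ey.
Qed.

(** The sets (class of a in A) D, for distinct classes, are disjoint because D
    lies in a single class; if each of them were at least twice as large as its
    class, then A D would be at least twice as large as A. *)
Lemma small_growth_class (A D : {fset nat}) :
  (forall n : nat, n \in A -> (0 < n)%N) ->
  (forall n : nat, n \in D -> (0 < n)%N) ->
  (forall x y : nat, x \in D -> y \in D -> eqv x y) ->
  (#|` prodfs A D| < 2 * #|` A|)%N ->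
  exists2 a : nat, a \in A &
    (#|` prodfs (eqv_class A a) D| <=
      2 * #|` eqv_class A a|)%N.
Proof.
move=> A0 D0 De; apply: contraPP => H; apply/negP; rewrite -leqNgt.
have {}H (a : nat) : a \in A -> (2 * #|` eqv_class A a| <=
    #|` prodfs (eqv_class A a) D|)%N.
  by move=> aA; rewrite leqNgt; apply/negP => h; apply: H; exists a => //; exact: ltnW.
have [k] := ubnP #|` A|; elim: k => // k IH in A A0 H *; rewrite ltnS => Ak.
have [->|] := eqVneq A fset0; first by rewrite cardfs0.
move=> /fset0Pn[a aA].
pose Aa := eqv_class A a.
pose A1 := [fset x in A | ~~ `[< eqv a x >]]%fset.
have aAa : a \in Aa by rewrite !inE aA /=; apply/asboolP; exact: eqv_refl.
have cA : #|` A| = (#|` Aa| + #|` A1|)%N.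
  by rewrite /Aa /A1 !card_fset_sum1 (big_fsetID _ (fun x => `[< eqv a x >])).
have A1A : (A1 `<=` A)%fset by apply/fsubsetP => x; rewrite !inE => /andP[].
have h1 : (2 * #|` A1| <= #|` prodfs A1 D|)%N.
  apply: IH.
  - by move=> n /(fsubsetP A1A); exact: A0.
  - move=> x xA1; have := H x (fsubsetP A1A _ xA1).
    suff -> : eqv_class A x =
              eqv_class A1 x by [].
    apply/fsetP => y; rewrite !inE /=; apply/andP/andP => [[yA xy]|[/andP[yA _] xy]] //.
    split=> //; rewrite yA /=; apply/asboolP => ay.
    move: xA1; rewrite !inE => /andP[_ /asboolP[]].
    by apply: eqv_trans ay (eqv_sym _); exact/asboolP.
  apply: leq_trans Ak; rewrite cA -[ltnLHS]add0n ltn_add2r cardfs_gt0.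
  by apply/fset0Pn; exists a.
rewrite cA mulnDr; apply: leq_trans (leq_add (H a aA) h1) _.
rewrite -/Aa -cardfsUI.
have -> : (prodfs Aa D `&` prodfs A1 D)%fset = fset0.
  apply/fsetP => n; rewrite !inE; apply/negbTE/negP => /andP[].
  move=> /prodfsP[x [u [xAa uD ->]]] /prodfsP[y [v [yA1 vD e]]].
  move: yA1; rewrite !inE => /andP[yA /asboolP[]].
  move: xAa; rewrite !inE => /andP[xA /asboolP ax].
  apply: (eqv_trans ax); apply: (@eqv_mulr2 u); first exact: D0.
  by rewrite e; apply: eqv_mul2l; exact: De.
rewrite cardfs0 addn0; apply: fsubset_leq_card; apply/fsubsetP => n.
rewrite inE => /orP[] /prodfsP[x [u [xA uD ->]]]; apply: mem_prodfs => //.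
  by move: xA; rewrite !inE => /andP[].
exact: (fsubsetP A1A).
Qed.

Lemma mem_mul_monomial n (c : 'I_d -> nat) : S n -> S (n * monomial c)%N.
Proof. by case: Ssg => _ SM Sn; exact: mul_closed_prodX. Qed.

(** Let D be the largest class of S_X, enlarged up to the scale X^2 so that it
    contains n s^e for each n of that class and every 0-1 vector e. Then D^k
    contains n^k s^c for all n and all c with entries below k, and these are
    distinct by [eqv_expn_inj]: this is the left-hand side. On the other hand
    S_Y D lies in S_(Y X^2), so by smallness some class of S_Y at most doubles
    under D, and Pluennecke's inequality bounds D^k by the right-hand side. *)
Lemma max_class_size_growth X Y k : (monomial (fun=> 1%N) <= X)%N ->
  (#|` trunc_set S (Y * X ^ 2)| < 2 * #|` trunc_set S Y|)%N ->
  (k ^ d * max_class_size X <= 2 ^ k * max_class_size Y)%N.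
Proof.
move=> X0 small; have [Spos SM] := Ssg.
have [SX0|SX0] := eqVneq (trunc_set S X) fset0.
  by rewrite {1}/max_class_size SX0 big_nil muln0.
have : (enum_fset (trunc_set S X) != [::]).
  by case/fset0Pn: SX0 => n nS; apply/eqP => e; move: nS; rewrite -[_ \in _]/(_ \in enum_fset _) e.
move=> /(seq_argmax (fun n => #|` eqv_ball X n|))[n0 n0X n0max].
have mX : (max_class_size X <= #|` eqv_ball X n0|)%N.
  by apply/bigmax_leqP_seq => n nX _; exact: n0max.
have /trunc_setP[Sn0 n0leX] := n0X.
pose D := eqv_ball (X ^ 2) n0; pose A := trunc_set S Y.
have A0 (n : nat) : n \in A -> (0 < n)%N by move=> /trunc_setP[/Spos].
have D0 (n : nat) : n \in D -> (0 < n)%N by move=> /eqv_ballP[/Spos].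
have De (x y : nat) : x \in D -> y \in D -> eqv x y.
  by move=> /eqv_ballP[_ _ ex] /eqv_ballP[_ _ ey]; exact: eqv_trans (eqv_sym ex) ey.
have AD : (#|` prodfs A D| < 2 * #|` A|)%N.
  apply: leq_ltn_trans small; apply: fsubset_leq_card; apply/fsubsetP => n.
  move=> /prodfsP[x [y [/trunc_setP[Sx xY] /eqv_ballP[Sy yX _] ->]]]; apply/trunc_setP.
  by split; [exact: SM|exact: leq_mul].
have [a aA hA] := small_growth_class A0 D0 De AD.
set Aa := eqv_class A a in hA.
have Aa0 : Aa != fset0.
  by apply/fset0Pn; exists a; rewrite !inE aA; apply/asboolP; exact: eqv_refl.
have /(@plunnecke _ _ _ k) h1 := hA.
have {h1} : (#|` prodfs_exp D k| <= 2 ^ k * #|` Aa|)%N.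
  by apply: h1 => // n; rewrite !inE => /andP[/A0].
have AaY : (#|` Aa| <= max_class_size Y)%N.
  exact: (@leq_bigmax_seq _ _ _ (fun n => #|` eqv_ball Y n|) _ aA isT).
move=> h1; apply: leq_trans (_ : _ <= #|` prodfs_exp D k|)%N _; last first.
  by apply: leq_trans h1 _; rewrite leq_mul2l AaY orbT.
apply: leq_trans (_ : k ^ d * #|` eqv_ball X n0| <= _)%N.
  by rewrite leq_mul2l mX orbT.
have -> : (k ^ d * #|` eqv_ball X n0|)%N = #|{: {ffun 'I_d -> 'I_k} * eqv_ball X n0}|.
  by rewrite card_prod card_ffun !card_ord -cardfE.
have Dmem (n : nat) (e : 'I_d -> bool) : n \in eqv_ball X n0 ->
    (n * monomial (fun i => e i : nat))%N \in D.
  move=> /eqv_ballP[Sn nX en]; apply/eqv_ballP; split; first exact: mem_mul_monomial.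
    rewrite -mulnn leq_mul //; apply: leq_trans X0; apply: leq_prod => i _.
    by case: (e i); rewrite ?expn1 ?expn0 ?s0.
  exact: eqv_trans en (eqv_mul_monomial _ _).
have Pmem (n : nat) (c : 'I_d -> nat) t : n \in eqv_ball X n0 ->
    (n ^ t * monomial (fun i => minn (c i) t))%N \in prodfs_exp D t.
  move=> nX; elim: t => [|t IH] /=.
    rewrite inE expn0 mul1n /monomial big1 // => i _; by rewrite minn0.
  (* peel off the factor s i at the first t steps only as long as t < c i *)
  have -> : (n ^ t.+1 * monomial (fun i => minn (c i) t.+1))%N =
    ((n * monomial (fun i => (t < c i)%N : nat)) *
     (n ^ t * monomial (fun i => minn (c i) t)))%N.
    rewrite mulnACA -monomialD -expnS; congr muln; apply: eq_monomial => i.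
    by case: (ltnP t (c i)); lia.
  by apply: mem_prodfs => //; exact: Dmem.
pose f (x : {ffun 'I_d -> 'I_k} * eqv_ball X n0) :=
  ((val x.2) ^ k * monomial (fun i => x.1 i))%N.
apply: (@leq_card_of_fin _ _ f); last first.
  move=> [c n]; have := Pmem (val n) (fun i => c i) k (valP n).
  rewrite (_ : monomial _ = monomial (fun i => c i)) //; apply: eq_monomial => i.
  by apply/minn_idPl; apply: ltnW.
move=> [c n] [c' n']; rewrite /f /= => e.
have /eqv_ballP[Sn _ en] := valP n; have /eqv_ballP[_ _ en'] := valP n'.
have [] := eqv_expn_inj (Spos _ Sn) (eqv_trans (eqv_sym en) en') _ _ e.
- by [].
- by [].
move=> /val_inj -> cc; congr pair; apply/ffunP => i; apply: val_inj; exact: cc.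
Qed.

End classes.

(** * Successive doublings when the primes are unbounded *)

(** Suppose that no X works and write J = I+1. Applied to X^2, the failure
    gives at every scale X some i <= I to which [max_class_size_growth] applies
    with Y = X^(2i), so that, for k = d = 8 J, the largest class grows by the
    factor (d/2)^d = (4 J)^d between X and X^(2 J). Iterating j times from X0,
    it is at least (4 J)^(d j) at the scale X0^((2 J)^j), whereas the
    valuations bound it by ((w + 1) (2 J)^j)^d for a constant w. At j = w + 1
    this would give 2^(w + 1) <= w + 1. *)
Lemma doubling_steps S I : pos_semigroup S ->
  unbounded_primes S ->
  exists X, [/\ (1 < X)%N, (0 < #|` trunc_set S X|)%N &
   forall i, (0 < i <= I)%N ->
     (2 * #|` trunc_set S (X ^ i)| <= #|` trunc_set S (X ^ i.+1)|)%N].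
Proof.
move=> Ssg Sinf; pose J := I.+1; pose d := (8 * J)%N.
have [s' [p' H]] := triangular_family d Ssg Sinf.
pose s (i : 'I_d) := s' i; pose p (i : 'I_d) := p' i.
have Ss i : S (s i) by have [] := H i (ltn_ord i).
have pp i : prime (p i) by have [] := H i (ltn_ord i).
have ps i : (p i %| s i)%N by have [] := H i (ltn_ord i).
have pns (i j : 'I_d) : (j < i)%N -> ~~ (p i %| s j)%N.
  by have [_ _ _] := H i (ltn_ord i); apply.
have [Spos SM] := Ssg.
apply: contrapT => nex.
pose X0 := (2 * monomial s (fun=> 1%N))%N.
have mono0 := monomial_gt0 Ssg Ss (fun=> 1%N).
pose i0 : 'I_d := @Ordinal d 0 isT.
have s0X : (s i0 <= X0)%N.
  apply: leq_trans (_ : monomial s (fun=> 1%N) <= _)%N; last by rewrite /X0; lia.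
  rewrite /monomial (bigD1 i0) //= expn1 leq_pmulr // prodn_cond_gt0 // => i _.
  by rewrite expn1 (Spos _ (Ss i)).
pose mc := max_class_size S s.
have step X : (X0 <= X)%N -> ((4 * J) ^ d * mc X <= mc (X ^ (2 * J)))%N.
  move=> XX; have X1 : (1 < X)%N by apply: leq_trans XX; rewrite /X0; lia.
  have [i [i1 iI small]] : exists i, [/\ (0 < i)%N, (i <= I)%N &
      (#|` trunc_set S ((X ^ 2) ^ i.+1)| < 2 * #|` trunc_set S ((X ^ 2) ^ i)|)%N].
    apply: contrapT => H'; apply: nex; exists (X ^ 2)%N; split.
    - by rewrite -[ltnLHS](exp1n 2) ltn_exp2r.
    - rewrite cardfs_gt0; apply/fset0Pn; exists (s i0); apply/trunc_setP; split=> //.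
      by apply: leq_trans s0X _; apply: leq_trans XX _; rewrite -mulnn; nia.
    - move=> i /andP[i1 iI]; rewrite leqNgt; apply/negP => lt.
      by apply: H'; exists i.
  rewrite expnSr in small.
  have monoX : (monomial s (fun=> 1%N) <= X)%N.
    by apply: leq_trans XX; rewrite /X0; lia.
  have := max_class_size_growth Ssg Ss pp ps pns d monoX small.
  have -> : (d ^ d = 2 ^ d * (4 * J) ^ d)%N by rewrite -expnMn /d mulnA.
  rewrite -mulnA leq_pmul2l ?expn_gt0 // => h; apply: leq_trans h _.
  apply: leq_max_class_size; rewrite -expnM leq_exp2l // leq_mul2l.
  exact: leqW.
have iter j : (((4 * J) ^ d) ^ j <= mc (X0 ^ ((2 * J) ^ j)))%N.
  elim: j => [|j IH].
    rewrite !expn0 expn1; have sX : s i0 \in trunc_set S X0 by apply/trunc_setP.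
    apply: leq_trans (@leq_bigmax_seq _ _ _ (fun n => #|` eqv_ball S s X0 n|) _ sX isT).
    rewrite cardfs_gt0; apply/fset0Pn; exists (s i0); apply/eqv_ballP.
    by split=> //; exact: eqv_refl.
  rewrite expnS [X in (X0 ^ X)%N]expnSr expnM.
  apply: leq_trans (step _ _); first by rewrite leq_mul2l IH orbT.
  by rewrite -[leqLHS]expn1 leq_pexp2l ?expn_gt0 // /X0; lia.
pose w := (trunc_log 2 X0).+1.
have X0w : (X0 < 2 ^ w)%N by rewrite trunc_log_ltn.
have upper m : (0 < m)%N -> (mc (X0 ^ m) <= (w.+1 * m) ^ d)%N.
  move=> m0; apply: leq_trans (max_class_size_bound Ssg Ss pp ps pns _) _.
  rewrite leq_exp2r //.
  have : (trunc_log 2 (X0 ^ m) <= w * m)%N.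
    rewrite -(@leq_exp2l 2) //; apply: leq_trans (trunc_logP _ _) _ => //.
      by rewrite expn_gt0 /X0 muln_gt0 mono0.
    by rewrite expnM leq_exp2r // ltnW.
  by move: (trunc_log _ _) => x; nia.
have := leq_trans (iter w.+1) (upper _ _); rewrite expn_gt0 => /(_ isT).
rewrite -expnM [(d * _)%N]mulnC expnM leq_exp2r //.
have -> : (4 * J = 2 * (2 * J))%N by rewrite mulnA.
rewrite [X in (X <= _)%N]expnMn leq_pmul2r ?expn_gt0 //.
by rewrite leqNgt ltn_expl.
Qed.

Definition smooth B := [set m : nat | (0 < m)%N /\
  forall p, prime p -> (p %| m)%N -> (p <= B)%N].

Lemma smooth_semigroup B : pos_semigroup (smooth B).
Proof.
split=> [m [] //|m n [m0 mB] [n0 nB]]; split; first by rewrite muln_gt0 m0.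
by move=> p pp; rewrite Euclid_dvdM // => /orP[/mB|/nB]; apply.
Qed.

Lemma smooth_dvd B m n : smooth B m -> (n %| m)%N -> smooth B n.
Proof.
move=> [m0 mB] nm; split; first exact: dvdn_gt0 nm.
by move=> p pp pn; apply: mB => //; exact: dvdn_trans nm.
Qed.

Lemma smooth_fact B : smooth B B`!.
Proof.
split; first exact: fact_gt0.
move=> p pp; elim: B => [|B IH]; first by rewrite fact0 Euclid_dvd1.
rewrite factS Euclid_dvdM // => /orP[/dvdn_leq -> //|/IH]; exact: leqW.
Qed.

(** The numbers of smooth integers up to P^j would otherwise grow at least like
    2^j, against the bound |S_(N^2)| <= C |S_N| for N = P^C. *)
Lemma smooth_folner B P : (1 < P)%N -> exists Y,
  (0 < #|` trunc_set (smooth B) Y|)%N /\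
  (#|` trunc_set (smooth B) (P * Y)| <= 2 * #|` trunc_set (smooth B) Y|)%N.
Proof.
move=> P1.
have [C C0 HC] := @semigroup_doubling (smooth B) B (smooth_semigroup B)
  (fun n p nB pp pn => nB.2 p pp pn).
pose g j := #|` trunc_set (smooth B) (P ^ j)|.
have g0 j : (0 < g j)%N.
  rewrite cardfs_gt0; apply/fset0Pn; exists 1%N; apply/trunc_setP.
  split; last by rewrite expn_gt0 ltnW.
  by split=> // p pp; rewrite Euclid_dvd1.
apply: contrapT => H.
have gS j : (2 * g j <= g j.+1)%N.
  rewrite leqNgt; apply/negP => lt; apply: H; exists (P ^ j)%N; split.
    exact: g0.
  by rewrite -expnS; exact: ltnW.
have gX j k : (2 ^ k * g j <= g (j + k))%N.
  elim: k => [|k IH]; first by rewrite mul1n addn0.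
  by rewrite addnS; apply: leq_trans (gS _); rewrite expnS -mulnA leq_mul2l IH orbT.
have := gX C C; have [+ _] := HC _ (g0 C).
rewrite -expnM -/(g _) muln2 -addnn => h1 h2; have := leq_trans h2 h1.
by rewrite leq_pmul2r // leqNgt ltn_expl.
Qed.

(** Let X be given by [doubling_steps], B = X^(I+1) and P = B!. Take L1 to be
    the multiples P m of B-smooth numbers m up to a Foelner bound Y, so that
    they are divisible by every n up to B, and L0 to be the B-smooth numbers up
    to P Y for which floor(log_X m) or its successor is congruent to j modulo
    I. Summed over j, the sizes of these sets give at most twice the number of
    smooth numbers up to P Y, so that L0 has proportion at most 2/I for some j.
    For m in L1 choose i between 1 and I with floor(log_X m) congruent to j +
    i: every n of S with X^i < n <= X^(i+1), that is at least half of
    S_(X^(i+1)), satisfies floor(log_X (m/n)) = floor(log_X m) - i or one less,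
    hence m/n is in L0. *)
Lemma tower_sets S I : pos_semigroup S -> (0 < I)%N ->
  unbounded_primes S ->
  exists L0 L1 : {fset nat}, [/\ (0 < #|` L1|)%N,
    (I * #|` L0| <= 4 * #|` L1|)%N,
    (forall m : nat, m \in L0 -> (0 < m)%N),
    (forall m : nat, m \in L1 -> (0 < m)%N) &
    forall m : nat, m \in L1 -> exists2 N, (0 < #|` trunc_set S N|)%N &
      (#|` trunc_set S N| <= 2 *
        #|` [fset n in trunc_set S N | (n %| m)%N && ((m %/ n)%N \in L0)]%fset|)%N].
Proof.
move=> Ssg I0 Sinf; have [X [X1 SX0 HX]] := doubling_steps I Ssg Sinf.
have [Spos SM] := Ssg.
pose B := (X ^ I.+1)%N; pose P := B`!.
have B2 : (1 < B)%N by rewrite -[ltnLHS](exp1n I.+1) ltn_exp2r.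
have P1 : (1 < P)%N.
  apply: (leq_trans B2); apply: dvdn_leq; first exact: fact_gt0.
  by apply: dvdn_fact; rewrite leqnn andbT (ltnW B2).
have [Y [LY0 LY]] := smooth_folner B P1.
pose L := trunc_set (smooth B) (P * Y).
pose L1 : {fset nat} := [fset (m * P)%N | m in trunc_set (smooth B) Y]%fset.
have cL1 : #|` L1| = #|` trunc_set (smooth B) Y|.
  by rewrite card_fset_mulr // ltnW.
have L1L (m : nat) : m \in L1 -> (P %| m)%N /\ m \in L.
  move=> /imfsetP[m' /= /trunc_setP[m's m'Y] ->]; split; first exact: dvdn_mull.
  apply/trunc_setP; split; last by rewrite mulnC leq_mul2l m'Y orbT.
  by have [_] := smooth_semigroup B; apply => //; exact: smooth_fact.
pose f m := trunc_log X m.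
pose Q (j m : nat) := (f m %% I == j)%N || ((f m).+1 %% I == j)%N.
have [j jI Lj] : exists2 j, (j < I)%N &
    (I * #|` [fset m in L | Q j m]%fset| <= 2 * #|` L|)%N.
  apply: contrapT => H.
  have h (j : 'I_I) : (2 * #|` L| < I * #|` [fset m in L | Q j m]%fset|)%N.
    by rewrite ltnNge; apply/negP => le; apply: H; exists j.
  have : (\sum_(j < I) (2 * #|` L|).+1 <=
      \sum_(j < I) I * #|` [fset m in L | Q j m]%fset|)%N by apply: leq_sum => j _; exact: h.
  rewrite sum_nat_const card_ord -big_distrr /= leq_pmul2l // ltnNge => /negP; apply.
  have one (r : nat) : (\sum_(j < I) (r %% I == j :> nat)%N = 1)%N.
    have rI : (r %% I < I)%N by rewrite ltn_mod.
    rewrite (bigD1 (Ordinal rI)) //= eqxx big1 // => j; rewrite -val_eqE /= eq_sym.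
    by move=> /negbTE ->.
  apply: leq_trans (_ : \sum_(j < I) \sum_(m <- L)
      ((f m %% I == j) + ((f m).+1 %% I == j))%N <= _)%N.
    apply: leq_sum => j _.
    rewrite card_fset_sum1 big_fset /= big_mkcond /=; apply: leq_sum => m _.
    by rewrite /Q; case: (f m %% I == j)%N; case: ((f m).+1 %% I == j)%N.
  rewrite exchange_big /=; under eq_bigr => m _ do rewrite big_split /= !one.
  by rewrite big_const_seq count_predT iter_addn_0.
exists [fset m in L | Q j m]%fset, L1; split.
- by rewrite cL1.
- apply: leq_trans Lj _; rewrite cL1 (_ : 4 = 2 * 2)%N // -mulnA leq_mul2l.
  exact: LY.
- by move=> m; rewrite !inE => /andP[/trunc_setP[[]]].
- by move=> m /L1L[_ /trunc_setP[[]]].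
move=> m mL1; have [Pm mL] := L1L _ mL1; have /trunc_setP[msm mPY] := mL.
have m0 := msm.1.
(* the representative between 1 and I, not between 0 and I-1, of f m - j *)
pose i := (((f m + (I - j)).-1 %% I).+1)%N.
have iI : (0 < i <= I)%N by rewrite /i /= ltn_mod.
have ij : (f m %% I = (j + i) %% I)%N.
  rewrite /i addnS -addSn modnDmr.
  have -> : (j.+1 + (f m + (I - j)).-1 = f m + I)%N by lia.
  by rewrite modnDr.
exists (X ^ i.+1)%N.
  apply: leq_trans SX0 (fsubset_leq_card _); apply/fsubsetP => n /trunc_setP[Sn nX].
  apply/trunc_setP; split=> //; apply: leq_trans nX _.
  by rewrite -[leqLHS]expn1 leq_exp2l.
have := HX i iI.
set A := trunc_set S (X ^ i.+1).
set G := [fset n in A | _]%fset.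
suff : (#|` A| <= #|` trunc_set S (X ^ i)| + #|` G|)%N by lia.
rewrite -cardfsUI; apply: leq_trans (leq_addr _ _).
apply: fsubset_leq_card; apply/fsubsetP => n nA; have /trunc_setP[Sn nX] := nA.
rewrite inE; have [nXi|Xin] := leqP n (X ^ i).
  by apply/orP; left; apply/trunc_setP.
apply/orP; right; rewrite !inE /= nA /=.
have n0 : (0 < n)%N := Spos _ Sn.
have nm : (n %| m)%N.
  apply: dvdn_trans Pm; apply: dvdn_fact; rewrite n0 /=.
  by apply: leq_trans nX _; rewrite leq_exp2l // ltnS.
rewrite nm /=; set m' := (m %/ n)%N.
have mE : m = (m' * n)%N by rewrite divnK.
have m'0 : (0 < m')%N by move: m0; rewrite mE muln_gt0 => /andP[].
apply/andP; split.
  apply/trunc_setP; split; first by apply: smooth_dvd msm _; rewrite mE dvdn_mulr.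
  by apply: leq_trans mPY; rewrite mE leq_pmulr.
have /andP[tm1 tm2] := trunc_log_bounds X1 m0.
have /andP[tm'1 tm'2] := trunc_log_bounds X1 m'0.
rewrite -/(f m) -/(f m') in tm1 tm2 tm'1 tm'2.
have h1 : (f m' + i <= f m)%N.
  rewrite -ltnS -(@ltn_exp2l X) //; apply: leq_ltn_trans tm2.
  by rewrite expnD mE leq_mul // ltnW.
have h2 : (f m < f m' + i + 2)%N.
  rewrite -(@ltn_exp2l X) //; apply: leq_ltn_trans tm1 _.
  have -> : (f m' + i + 2 = (f m').+1 + i.+1)%N by lia.
  rewrite expnD mE; apply: leq_ltn_trans (leq_mul (leqnn _) nX) _.
  by rewrite ltn_pmul2r // expn_gt0 ltnW.
have jE : (j %% I = j)%N by rewrite modn_small.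
have cancel u : ((u + i) %% I = (j + i) %% I)%N -> (u %% I == j)%N.
  by move=> /eqP; rewrite eqn_modDr jE.
rewrite /Q; have [e|ne] := eqVneq (f m' + i)%N (f m).
  by apply/orP; left; apply: cancel; rewrite e.
by apply/orP; right; apply: cancel; rewrite -ij; congr modn; lia.
Qed.

(** * Dilations of the circle *)

Section affine.
Context (R : realType).
Local Notation mu := (@lebesgue_measure R).
Local Open Scope ereal_scope.

Lemma measurable_affine (a b : R) :
  measurable_fun [set: measurableTypeR R] (fun x : measurableTypeR R => (a * x - b)%R : measurableTypeR R).
Proof. by apply: measurable_funB => //; exact: measurable_funM. Qed.

Lemma lebesgue_measure_affine (a b : R) (V : set R) : (0 < a)%R -> measurable V ->
  mu ((fun x => a * x - b)%R @^-1` V) = (a^-1)%:E * mu V.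
Proof.
move=> a0 mV.
pose phi (x : measurableTypeR R) : measurableTypeR R := (a * x - b)%R.
have mphi : measurable_fun setT phi := measurable_affine a b.
pose m1 : {measure set (measurableTypeR R) -> \bar R} :=
  measure_function_pushforward__canonical__measure_function_Measure mu mphi.
pose m2 : {measure set (measurableTypeR R) -> \bar R} := mscale (NngNum (ltW a0)) m1.
have -> : mu V = m2 V.
  apply: lebesgue_measure_unique => // _ [[u v] _ <-] /=.
  rewrite /m2 /mscale /= /pushforward.
  have -> : phi @^-1` `]u, v] = `]((u + b) / a)%R, ((v + b) / a)%R]%classic.
    apply/seteqP; split => x /=; rewrite !in_itv /= /phi => /andP[h1 h2];
      apply/andP; split; move: h1 h2;
      rewrite ?ltr_pdivrMr ?ler_pdivlMr // ?[(x * a)%R]mulrC; lra.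
  rewrite !lebesgue_measure_itv /= !lte_fin.
  rewrite ltr_pM2r ?invr_gt0 // ltrD2r; case: ifP => _; last by rewrite mule0.
  by rewrite -!EFinB -EFinM; congr EFin; field; rewrite gt_eqF.
change (mu (phi @^-1` V) = (a^-1)%:E * (a%:E * mu (phi @^-1` V))).
by rewrite muleA -EFinM mulVf ?gt_eqF // mul1e.
Qed.
End affine.

Section dilation.
Context (R : realType).
Local Notation mu := (@lebesgue_measure R).

Definition dil (n : nat) (x : R) : R := Defs.frac (n%:R * x).

Lemma frac_itv (x : R) : 0 <= Defs.frac x < 1.
Proof.
have := floor_itv x; rewrite /Defs.frac intrD => /andP[h1 h2].
by apply/andP; split; lra.
Qed.

Lemma frac_small (x : R) : 0 <= x < 1 -> Defs.frac x = x.
Proof. by move=> x01; rewrite /Defs.frac (@floor_def _ _ 0) ?subr0. Qed.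

Lemma frac_addz (x : R) (k : int) : Defs.frac (x + k%:~R) = Defs.frac x.
Proof.
rewrite /Defs.frac floorDrz ?intr_int // intrD intrKfloor.
by rewrite opprD addrACA subrr addr0.
Qed.

Lemma dilM m n x : dil m (dil n x) = dil (m * n) x.
Proof.
rewrite /dil {2}/Defs.frac mulrBr mulrA -natrM.
rewrite -[RHS](frac_addz _ (- ((m : int) * Num.floor (n%:R * x)))).
by rewrite intrN intrM.
Qed.

Lemma dil1 x : 0 <= x < 1 -> dil 1 x = x.
Proof. by move=> h; rewrite /dil mul1r frac_small. Qed.

Definition I01 : set (measurableTypeR R) := `[0, 1[%classic.

Lemma I01E x : I01 x = (0 <= x < 1) :> Prop.
Proof. by rewrite /I01 /= in_itv. Qed.

Lemma measurable_I01 : measurable I01.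
Proof. exact: measurable_itv. Qed.
Hint Resolve measurable_I01 : core.

Lemma mu_I01 : mu I01 = 1%E.
Proof. by rewrite /I01 lebesgue_measure_itv /= lte_fin ltr01 oppr0 adde0. Qed.

Lemma dil_I01 n x : I01 (dil n x).
Proof. by rewrite I01E; exact: frac_itv. Qed.

Lemma measurable_frac :
  measurable_fun [set: measurableTypeR R] (fun x : measurableTypeR R => Defs.frac x : measurableTypeR R).
Proof.
apply: measurable_funB => //.
apply: nondecreasing_measurable => // x y xy; rewrite ler_int; exact: le_floor.
Qed.

Lemma measurable_dil n :
  measurable_fun [set: measurableTypeR R] (fun x : measurableTypeR R => dil n x : measurableTypeR R).
Proof.
apply: (measurableT_comp measurable_frac).
exact: measurable_funM.
Qed.

Lemma measurable_dil_preimage n V : measurable V ->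
  measurable (dil n @^-1` V : set (measurableTypeR R)).
Proof. by move=> mV; rewrite -[X in measurable X]setTI; exact: measurable_dil. Qed.

(** The points of [0, 1) whose first digit in base q is i. *)
Definition cell (q i : nat) : set (measurableTypeR R) :=
  `[i%:R / q%:R, i.+1%:R / q%:R[%classic.

Lemma cellE q i x : (0 < q)%N ->
  cell q i x = (i%:R <= q%:R * x < i.+1%:R) :> Prop.
Proof.
move=> q0; rewrite /cell /= in_itv /= ler_pdivrMr ?ltr0n //.
by rewrite ltr_pdivlMr ?ltr0n // mulrC.
Qed.

Lemma measurable_cell q i : measurable (cell q i).
Proof. exact: measurable_itv. Qed.
Hint Resolve measurable_cell : core.

Lemma cell_truncn q i x : (0 < q)%N -> 0 <= x ->
  cell q i x <-> Num.truncn (q%:R * x) = i.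
Proof.
move=> q0 x0; rewrite cellE // -truncn_eq ?mulr_ge0 //.
by split => /eqP.
Qed.

Lemma dil_cell q i x : (0 < q)%N -> cell q i x -> dil q x = q%:R * x - i%:R.
Proof.
move=> q0; rewrite cellE // => h; rewrite /dil /Defs.frac (@floor_def _ _ (i : int)) //.
by have -> : (i : int) + 1 = i.+1 :> int by rewrite -addn1 PoszD.
Qed.

Lemma cell_sub q i : (i < q)%N -> cell q i `<=` I01.
Proof.
move=> iq x; have q0 : (0 < q)%N by apply: leq_ltn_trans iq.
rewrite cellE // I01E => /andP[h1 h2]; apply/andP; split.
  by rewrite -(pmulr_rge0 _ (_ : 0 < q%:R)) ?ltr0n // (le_trans _ h1).
rewrite -(ltr_pM2l (_ : 0 < q%:R)) ?ltr0n // mulr1 (lt_le_trans h2) //.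
by rewrite ler_nat.
Qed.

Lemma truncn_lt q x : (0 < q)%N -> I01 x -> (Num.truncn (q%:R * x) < q)%N.
Proof.
move=> q0; rewrite I01E => /andP[x0 x1].
by rewrite truncn_lt_nat ?mulr_ge0 // -[ltRHS]mulr1 ltr_pM2l ?ltr0n.
Qed.

Lemma I01_cells q A : (0 < q)%N ->
  I01 `&` A = \big[setU/set0]_(i < q) (cell q i `&` A).
Proof.
move=> q0; rewrite -(bigcup_mkord _ (fun i => cell q i `&` A)).
apply/seteqP; split => x.
  move=> [xI Ax]; exists (Num.truncn (q%:R * x)); first exact: truncn_lt.
  split=> //; apply/cell_truncn => //.
  by move: xI; rewrite I01E => /andP[].
by move=> [i /= iq [xc Ax]]; split=> //; exact: cell_sub xc.
Qed.

Lemma trivIset_cell q A : (0 < q)%N ->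
  trivIset setT (fun i => cell q i `&` A).
Proof.
move=> q0; apply/trivIsetP => i j _ _ ij; apply/seteqP; split=> // x.
move=> [[+ _] [+ _]]; rewrite !cellE // => /andP[h1 h2] /andP[h3 h4].
have : (i < j.+1)%N by rewrite -(ltr_nat R) (le_lt_trans h1).
have : (j < i.+1)%N by rewrite -(ltr_nat R) (le_lt_trans h3).
by move: ij; rewrite neq_ltn; lia.
Qed.

Lemma measure_cells q A : (0 < q)%N -> measurable A ->
  mu (I01 `&` A) = (\sum_(i < q) mu (cell q i `&` A))%E.
Proof.
move=> q0 mA; rewrite (I01_cells _ q0) measure_bigsetU_ord //.
  by move=> i; exact: measurableI.
apply/trivIsetP => i j _ _ ij.
by have /trivIsetP := @trivIset_cell q A q0; apply.
Qed.

Local Open Scope ereal_scope.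
(** On a cell the dilation is the affine map x |-> q x - i onto [0, 1). *)
Lemma cell_dil q i V : (0 < q)%N -> measurable V ->
  mu (cell q i `&` dil q @^-1` V) = (q%:R^-1)%:E * mu (I01 `&` V).
Proof.
move=> q0 mV; rewrite -(@lebesgue_measure_affine _ _ i%:R) ?ltr0n //; last first.
  exact: measurableI.
congr (mu _); apply/seteqP; split => x.
  move=> [xc Vx]; split; rewrite /= -(dil_cell q0 xc) //; exact: dil_I01.
rewrite /= => -[]; rewrite I01E => /andP[h1 h2] h.
have xc : cell q i x.
  rewrite cellE // -subr_ge0 h1 /=; move: h2; rewrite -natr1.
  by rewrite ltrBlDr addrC.
by split=> //; rewrite /preimage /= (dil_cell q0 xc).
Qed.


Lemma measure_dil n V : (0 < n)%N -> measurable V ->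
  mu (I01 `&` dil n @^-1` V) = mu (I01 `&` V).
Proof.
move=> n0 mV; rewrite (measure_cells n0); last exact: measurable_dil_preimage.
under eq_bigr => i _ do rewrite cell_dil //.
rewrite -ge0_sume_distrl //.
rewrite sumEFin sumr_const card_ord -[(_ *+ n)%R]mulr_natr mulVf ?mul1e //.
by rewrite pnatr_eq0 -lt0n.
Qed.

Lemma cell_dil_mul r q i V : (0 < q)%N -> (0 < r)%N -> measurable V ->
  mu (cell q i `&` dil (r * q) @^-1` V) = (q%:R^-1)%:E * mu (I01 `&` V).
Proof.
move=> q0 r0 mV.
have -> : dil (r * q) @^-1` V = dil q @^-1` (dil r @^-1` V).
  by apply/seteqP; split => x; rewrite /preimage /= dilM.
by rewrite cell_dil ?measure_dil //; exact: measurable_dil_preimage.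
Qed.

(** Change of variables, valid on any set E for which the identity of measures
    holds. The pushforward of the measure requires a map on the whole line, so
    the dilation is modified outside E to take the value 2: the integral over [0,
    1) of the pushforward then sees the points of E only. *)
Lemma ge0_integral_dil (E : set (measurableTypeR R)) n (c : R) (f : R -> \bar R) :
  (0 <= c)%R -> measurable E ->
  (forall V, measurable V ->
     mu (E `&` dil n @^-1` V) = c%:E * mu (I01 `&` V)) ->
  measurable_fun I01 f -> (forall x, I01 x -> 0 <= f x) ->
  \int[mu]_(x in E) f (dil n x) = c%:E * \int[mu]_(x in I01) f x.
Proof.
move=> c0 mE HE mf f0.
pose phi (x : measurableTypeR R) : measurableTypeR R :=
  (\1_E x * dil n x + 2 * (1 - \1_E x))%R.
have mI : measurable_fun setT (\1_E : measurableTypeR R -> measurableTypeR R).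
  exact: measurable_indic.
have mphi : measurable_fun setT phi.
  apply: measurable_funD.
    by apply: measurable_funM => //; exact: measurable_dil.
  by apply: measurable_funM => //; apply: measurable_funB.
have phiE x : E x -> phi x = dil n x.
  by move=> Ex; rewrite /phi indicE mem_set //= mul1r subrr mulr0 addr0.
have phiN x : ~ E x -> phi x = (2 : R)%R.
  by move=> Ex; rewrite /phi indicE memNset //= mul0r subr0 mulr1 add0r.
have n2 : ~ I01 (2 : R)%R by rewrite I01E => /andP[_]; lra.
have pre V : V `<=` I01 -> phi @^-1` V = E `&` dil n @^-1` V.
  move=> VI; apply/seteqP; split => x; rewrite /preimage /=.
    have [Ex|nEx] := pselect (E x); first by rewrite phiE.
    by rewrite phiN // => /VI.
  by move=> [Ex]; rewrite phiE.
transitivity (\int[pushforward mu phi]_(y in I01) f y).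
  rewrite ge0_integral_pushforward //; last by move=> y; rewrite inE; exact: f0.
  rewrite pre //; have -> : E `&` dil n @^-1` I01 = E.
    by apply/seteqP; split => [x []//|x Ex]; split=> //; exact: dil_I01.
  by apply: eq_integral => x; rewrite inE => Ex /=; rewrite phiE.
rewrite -(ge0_integral_mscale mu _ (NngNum c0)) //.
apply: eq_measure_integral => A mA AI.
change (mu (phi @^-1` A) = c%:E * mu A).
by rewrite pre // HE // setIidr.
Qed.

Lemma ge0_integral_dil_I01 n (f : R -> \bar R) : (0 < n)%N ->
  measurable_fun I01 f -> (forall x, I01 x -> 0 <= f x) ->
  \int[mu]_(x in I01) f (dil n x) = \int[mu]_(x in I01) f x.
Proof.
move=> n0 mf f0; rewrite (@ge0_integral_dil _ _ 1%R) ?mul1e //.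
by move=> V mV; rewrite mul1e measure_dil.
Qed.

Lemma ge0_integral_dil_cell r q i (f : R -> \bar R) : (0 < q)%N -> (0 < r)%N ->
  measurable_fun I01 f -> (forall x, I01 x -> 0 <= f x) ->
  \int[mu]_(x in cell q i) f (dil (r * q) x) =
    (q%:R^-1)%:E * \int[mu]_(x in I01) f x.
Proof.
move=> q0 r0 mf f0.
rewrite (@ge0_integral_dil _ _ (q%:R^-1)) //.
by move=> V mV; rewrite cell_dil_mul.
Qed.

End dilation.

Arguments I01 {R}.
Arguments measurable_I01 {R}.
#[export] Hint Resolve measurable_I01 measurable_cell : core.

(** * The maximal inequality *)

Section maximal.
Context (R : realType).
Local Notation mu := (@lebesgue_measure R).

Lemma sume_const_seq (T : Type) (s : seq T) (c : \bar R) : (0 <= c)%E ->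
  (\sum_(i <- s) c = (size s)%:R%:E * c)%E.
Proof.
move=> c0; elim: s => [|a s IH]; first by rewrite big_nil mul0e.
rewrite big_cons IH /= -addn1 natrD EFinD ge0_muleDl ?lee_fin // mul1e.
by rewrite addeC.
Qed.

Lemma trunc_set_gt0 S N n : pos_semigroup S -> n \in trunc_set S N -> (0 < n)%N.
Proof. by move=> [Spos _] /trunc_setP[/Spos]. Qed.

Lemma dil_avgE S (f : R -> R) N x : dil_avg S f N x =
  (\sum_(n <- trunc_set S N) f (dil n x)) / #|` trunc_set S N|%:R.
Proof. by []. Qed.

Lemma measurable_comp_dil (f : R -> R) n : measurable_fun I01 f ->
  measurable_fun I01 (fun x => f (dil n x)).
Proof.
move=> mf; rewrite -[X in measurable_fun _ X]/(f \o dil n).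
apply: (measurable_comp (F := I01)) => //.
- by move=> _ [x _ <-]; exact: dil_I01.
- by apply: measurable_funTS; exact: measurable_dil.
Qed.

Lemma measurable_norm_dist (f g : R -> R) : measurable_fun I01 f ->
  measurable_fun I01 g -> measurable_fun I01 (fun x => `|f x - g x|).
Proof.
move=> mf mg; apply: (measurableT_comp (@normr_measurable R setT)).
exact: measurable_funB.
Qed.

Lemma measurable_dil_avg S (f : R -> R) N : measurable_fun I01 f ->
  measurable_fun I01 (dil_avg S f N).
Proof.
move=> mf; apply: measurable_funM => //.
by apply: measurable_sum => n; exact: measurable_comp_dil.
Qed.

Definition max_avg_set S (f : R -> R) (lam : R) J : set (measurableTypeR R) :=
  [set x | I01 x /\ exists2 N, (N <= J)%N & lam < dil_avg S f N x].

Lemma measurable_max_avg_set S (f : R -> R) (lam : R) J : measurable_fun I01 f ->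
  measurable (max_avg_set S f lam J).
Proof.
move=> mf.
have -> : max_avg_set S f lam J =
    \bigcup_(N in `I_J.+1) (I01 `&` [set x | lam < dil_avg S f N x]).
  apply/seteqP; split=> x.
    by move=> [xI [N NJ h]]; exists N.
  by move=> [N NJ [xI h]]; split=> //; exists N.
apply: bigcup_measurable => N _.
have := measurable_dil_avg S N mf measurable_I01 (measurable_itv `]lam, +oo[).
by congr measurable; apply/seteqP; split => x [xI]; rewrite /preimage /= in_itv /= andbT.
Qed.

(** The covering lemma along the orbit of y, for the function t |-> f (t y mod
    1): the left sum counts the n in S_J for which some average of f over n
    S_N, N <= J, is large, and each n S_N lies in S_(J^2). *)
Lemma maximal_pointwise S C (f : R -> R) (lam : R) J (y : R) : pos_semigroup S ->
  (forall N, (0 < #|` trunc_set S N|)%N -> tempelman S C N) ->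
  (forall x, I01 x -> 0 <= f x) -> 0 < lam ->
  lam * (\sum_(n <- trunc_set S J) \1_(max_avg_set S f lam J) (dil n y)) <=
    C%:R * \sum_(t <- trunc_set S (J ^ 2)) f (dil t y).
Proof.
move=> Ssg HC f0 lam0; have [Spos SM] := Ssg.
set E := max_avg_set S f lam J.
pose B := [fset n in trunc_set S J | `[< E (dil n y) >]]%fset.
have -> : \sum_(n <- trunc_set S J) \1_E (dil n y) = #|` B|%:R :> R.
  rewrite card_fset_sum1 natr_sum big_fset /= [RHS]big_mkcond /=.
  apply: eq_bigr => n _; rewrite indicE.
  by case: asboolP => h; [rewrite mem_set|rewrite memNset].
have Hex (n : nat) : exists m : nat, n \in B ->
    (m <= J)%N /\ lam < dil_avg S f m (dil n y).
  have [nB|] := boolP (n \in B); last by exists 0%N.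
  move: nB; rewrite !inE => /andP[_ /asboolP[_ [N NJ lamN]]].
  by exists N.
have [h Hh] := boolp.choice Hex.
apply: (@vitali_semigroup _ S C (fun t => f (dil t y)) h) => //.
- by move=> n; apply: f0; exact: dil_I01.
- exact: ltW.
- move=> n nB; have [hJ lamh] := Hh _ nB.
  have /trunc_setP[Sn nJ] : n \in trunc_set S J by move: nB; rewrite !inE => /andP[].
  have card0 : (0 < #|` trunc_set S (h n)|)%N.
    rewrite lt0n; apply/eqP => e; move: lamh.
    by rewrite dil_avgE e invr0 mulr0 ltNge (ltW lam0).
  split=> //.
    move: lamh; rewrite dil_avgE ltr_pdivlMr ?ltr0n // => /ltW.
    move=> /le_trans; apply; apply: ler_sum => s _.
    by rewrite dilM mulnC.
  move=> s /trunc_setP[Ss sh]; apply/trunc_setP; split; first exact: SM.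
  by rewrite -mulnn leq_mul // (leq_trans sh).
Qed.

Local Open Scope ereal_scope.

(** Integrate [maximal_pointwise] over y. As every dilation preserves the
    measure, the left side becomes lam |S_J| mu E and the right side C
    |S_(J^2)| times the integral of f, and |S_(J^2)| <= C |S_J|. *)
Lemma dil_maximal_inequality S C (f : R -> R) (lam : R) J : pos_semigroup S ->
  (forall N, (0 < #|` trunc_set S N|)%N ->
    (#|` trunc_set S (N ^ 2)| <= C * #|` trunc_set S N|)%N /\
    tempelman S C N) ->
  measurable_fun I01 f -> (forall x, I01 x -> (0 <= f x)%R) -> (0 < lam)%R ->
  lam%:E * mu (max_avg_set S f lam J) <= (C * C)%:R%:E * \int[mu]_(x in I01) (f x)%:E.
Proof.
move=> Ssg HC mf f0 lam0.
set E := max_avg_set S f lam J; set A := trunc_set S J.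
have mE : measurable E by exact: measurable_max_avg_set.
have intf0 : 0 <= \int[mu]_(x in I01) (f x)%:E.
  by apply: integral_ge0 => x xI; rewrite lee_fin f0.
have [A0|A0] := posnP #|` A|.
  (* an empty S_J makes all averages up to J vanish *)
  suff -> : E = set0 by rewrite measure0 mule0 mule_ge0 // lee_fin.
  apply/seteqP; split=> // x [xI [N NJ]].
  have -> : dil_avg S f N x = 0%R; last by move=> /lt_trans /(_ lam0); rewrite ltxx.
  rewrite dil_avgE (_ : #|` trunc_set S N| = 0)%N ?invr0 ?mulr0 //.
  apply/eqP; rewrite -leqn0 -A0; apply: fsubset_leq_card; apply/fsubsetP => n.
  by move=> /trunc_setP[Sn nN]; apply/trunc_setP; split=> //; exact: leq_trans NJ.
have [dbl _] := HC _ A0.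
have A1 : (0 < #|` A|%:R :> R)%R by rewrite ltr0n.
rewrite -(@lee_pmul2l _ (#|` A|%:R)%:E) ?lte_fin //.
have mind n : measurable_fun I01 (fun y => (\1_E (dil n y) : R)).
  by apply: measurable_comp_dil; exact: measurable_indic.
have intE n : n \in A -> \int[mu]_(y in I01) (\1_E (dil n y))%:E = mu E.
  move=> nA; rewrite (@ge0_integral_dil_I01 _ n (fun y => (\1_E y)%:E)).
  - rewrite integral_indic // setIidl // => x [] //.
  - exact: trunc_set_gt0 nA.
  - by apply/measurable_EFinP; exact: measurable_indic.
  - by move=> x _; rewrite lee_fin.
have -> : (#|` A|%:R)%:E * (lam%:E * mu E) =
    \int[mu]_(y in I01) (lam * \sum_(n <- A) \1_E (dil n y))%:E.
  under eq_integral do rewrite EFinM -sumEFin.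
  rewrite ge0_integralZl_EFin //; last 3 first.
  - by move=> y _; apply: sume_ge0 => n _; rewrite lee_fin.
  - apply: emeasurable_sum => n; exact/measurable_EFinP.
  - exact: ltW.
  rewrite ge0_integral_sum //; last by move=> n; exact/measurable_EFinP.
  rewrite (eq_big_seq (fun=> mu E)); last by move=> n nA; rewrite intE.
  rewrite muleCA; congr (_ * _).
  by rewrite sume_const_seq ?measure_ge0.
apply: (@le_trans _ _ (\int[mu]_(y in I01)
   (C%:R * \sum_(t <- trunc_set S (J ^ 2)) f (dil t y))%:E)).
  apply: ge0_le_integral => //.
  - by move=> y _; rewrite lee_fin mulr_ge0 ?(ltW lam0) // sumr_ge0.
  - apply/measurable_EFinP/measurable_funM => //.
    by apply: measurable_sum.
  - apply/measurable_EFinP/measurable_funM => //.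
    by apply: measurable_sum => n; exact: measurable_comp_dil.
  move=> y _; rewrite lee_fin; apply: maximal_pointwise => //.
  by move=> N N0; have [] := HC _ N0.
under eq_integral do rewrite EFinM -sumEFin.
rewrite ge0_integralZl_EFin //; last 2 first.
- by move=> y _; apply: sume_ge0 => n _; rewrite lee_fin f0 //; exact: dil_I01.
- apply: emeasurable_sum => n; apply/measurable_EFinP.
  exact: measurable_comp_dil.
rewrite ge0_integral_sum //; last 2 first.
- by move=> n; apply/measurable_EFinP; exact: measurable_comp_dil.
- by move=> n y _; rewrite lee_fin f0 //; exact: dil_I01.
rewrite (eq_big_seq (fun=> \int[mu]_(x in I01) (f x)%:E)); last first.
  move=> n nA; rewrite (@ge0_integral_dil_I01 _ n (fun x => (f x)%:E)) //.
  - exact: trunc_set_gt0 nA.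
  - exact/measurable_EFinP.
rewrite sume_const_seq // !muleA -!EFinM lee_wpmul2r // lee_fin.
by rewrite -!natrM ler_nat [leqRHS]mulnC -mulnA leq_mul2l dbl orbT.
Qed.

End maximal.

(** * Step functions and sums over digits *)

Section dense.
Context (R : realType).
Local Notation mu := (@lebesgue_measure R).
Implicit Types (a : nat -> R) (q : nat) (x : R).

Definition step q a x : R := a (Num.truncn (q%:R * x)).

Lemma step_cell q a i x : (0 < q)%N -> (i < q)%N -> cell q i x -> step q a x = a i.
Proof.
move=> q0 iq xc; rewrite /step; congr a; apply/(@cell_truncn _ q) => //.
by have := cell_sub iq xc; rewrite I01E => /andP[].
Qed.

Lemma I01_bigcell q : (0 < q)%N ->
  I01 = \big[setU/set0]_(i < q) cell q i :> set (measurableTypeR R).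
Proof.
move=> q0; rewrite -[LHS]setIT (I01_cells _ q0).
by apply: eq_bigr => i _; rewrite setIT.
Qed.

Lemma mu_cell q i : (0 < q)%N -> (mu (cell q i) = (q%:R^-1)%:E)%E.
Proof.
move=> q0; have := @cell_dil R q i setT q0 measurableT.
by rewrite preimage_setT !setIT mu_I01 mule1.
Qed.

Lemma trivIset_cells q (D : set nat) : (0 < q)%N ->
  trivIset D (fun i => cell q i : set (measurableTypeR R)).
Proof.
move=> q0; apply: (@sub_trivIset _ _ _ setT) => //.
have := @trivIset_cell R q setT q0; congr trivIset.
by apply/funext => i; rewrite setIT.
Qed.

Lemma trivIset_cells_ord q (D : set 'I_q) : (0 < q)%N ->
  trivIset D (fun i : 'I_q => cell q i : set (measurableTypeR R)).
Proof.
move=> q0; apply/trivIsetP => i j _ _ ij.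
by have /trivIsetP := @trivIset_cells q setT q0; apply.
Qed.

Lemma ge0_integral_cells q (f : R -> \bar R) : (0 < q)%N ->
  measurable_fun I01 f -> (forall x, I01 x -> 0 <= f x)%E ->
  (\int[mu]_(x in I01) f x = \sum_(i < q) \int[mu]_(x in cell q i) f x)%E.
Proof.
move=> q0 mf f0; rewrite (I01_bigcell q0) ge0_integral_bigsetU //.
- by rewrite index_enum_uniq.
- exact: trivIset_cells_ord.
- by rewrite -I01_bigcell.
- by rewrite -I01_bigcell.
Qed.

Lemma measurable_step q a : (0 < q)%N -> measurable_fun I01 (step q a).
Proof.
move=> q0.
apply: (@eq_measurable_fun _ _ _ _ _ (fun x => \sum_(i < q) a i * \1_(cell q i) x)).
  move=> x; rewrite inE => xI; pose i := Ordinal (truncn_lt q0 xI).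
  have x0 : 0 <= x by have := xI; rewrite I01E => /andP[].
  have xc : cell q i x by apply/cell_truncn.
  rewrite (bigD1 i) //= indicE mem_set // mulr1 big1 ?addr0 //.
  move=> j ji; rewrite indicE memNset ?mulr0 // => /cell_truncn => /(_ q0 x0) e.
  by move/eqP: ji; apply; apply: val_inj; rewrite /= -e.
apply: measurable_sum => i; apply: measurable_funM => //.
by apply: measurable_indic; exact: measurable_cell.
Qed.

Lemma step_bounded q (a : nat -> R) x : (0 < q)%N -> I01 x ->
  `|step q a x| <= \sum_(i < q) `|a i|.
Proof.
move=> q0 xI; rewrite /step; pose i := Ordinal (truncn_lt q0 xI).
by rewrite (bigD1 i) //= lerDl sumr_ge0.
Qed.

Lemma integrable_step q a : (0 < q)%N -> mu.-integrable I01 (EFin \o step q a).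
Proof.
move=> q0; apply: measurable_bounded_integrable => //.
- by suff : (mu I01 < +oo)%E by []; rewrite mu_I01 ltry.
- exact: measurable_step.
exists (\sum_(i < q) `|a i|); split; first exact: num_real.
by move=> M hM x xI; apply: le_trans (ltW hM); exact: step_bounded.
Qed.

Lemma Rintegral_step q a : (0 < q)%N ->
  \int[mu]_(x in I01) step q a x = (\sum_(i < q) a i) / q%:R.
Proof.
move=> q0; rewrite /Rintegral.
have -> : (\int[mu]_(x in I01) (step q a x)%:E)%E =
    (\sum_(i < q) (a i * q%:R^-1)%:E)%E.
  rewrite (I01_bigcell q0) integral_bigsetU_EFin //.
  - apply: eq_bigr => i _.
    rewrite (eq_integral (fun=> (a i)%:E)); last first.
      by move=> x; rewrite inE => xc; rewrite (step_cell _ q0 (ltn_ord i) xc).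
    by rewrite integral_cst // EFinM; congr (_ * _)%E; exact: mu_cell.
  - by rewrite index_enum_uniq.
  - exact: trivIset_cells_ord.
  - rewrite -I01_bigcell //; apply/measurable_EFinP; exact: measurable_step.
by rewrite sumEFin /= mulr_suml.
Qed.

(** For a step function g, the sum of g over the first m digits in base q. *)
Definition birkhoff q (g : R -> R) m x := \sum_(j < m) g (dil (q ^ j) x).

Lemma measurable_birkhoff q g m : measurable_fun I01 g ->
  measurable_fun I01 (birkhoff q g m).
Proof. by move=> mg; apply: measurable_sum => j; exact: measurable_comp_dil. Qed.

Lemma birkhoffS q g m x : I01 x ->
  birkhoff q g m.+1 x = g x + birkhoff q g m (dil q x).
Proof.
rewrite I01E => xI; rewrite /birkhoff big_ord_recl expn0 dil1 //.
congr (_ + _); apply: eq_bigr => j _.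
by rewrite dilM -expnSr.
Qed.

(** The digits are independent, so the variances add up. Instead of expanding
    the square, the first digit is integrated out: on the cell i the sum of m+1
    digits is a i plus the sum of the next m digits of the dilated point, and
    the constant t absorbs a i in the induction. *)
Lemma birkhoff_square q a m t : (0 < q)%N -> \sum_(i < q) a i = 0 ->
  (\int[mu]_(x in I01) ((t + birkhoff q (step q a) m x) ^+ 2)%:E =
   (t ^+ 2 + m%:R * ((\sum_(i < q) a i ^+ 2) / q%:R))%:E)%E.
Proof.
move=> q0 a0; set v := (_ / _).
have q1 : q%:R != 0 :> R by rewrite pnatr_eq0 -lt0n.
have mstep := measurable_step a q0.
have msq u m' : measurable_fun I01
    (fun x => ((u + birkhoff q (step q a) m' x) ^+ 2)%:E).
  apply/measurable_EFinP; apply: measurable_funX; apply: measurable_funD => //.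
  exact: measurable_birkhoff.
elim: m t => [|m IH] t.
  rewrite mul0r addr0 (eq_integral (fun=> (t ^+ 2)%:E)); last first.
    by move=> x _; rewrite /birkhoff big_ord0 addr0.
  by rewrite integral_cst // -[RHS]mule1; congr (_ * _)%E; exact: mu_I01.
rewrite (ge0_integral_cells q0) //; last by move=> x _; rewrite lee_fin sqr_ge0.
rewrite (eq_bigr (fun i : 'I_q =>
   (q%:R^-1 * ((t + a i) ^+ 2 + m%:R * v))%:E)); last first.
  move=> i _; rewrite EFinM -IH.
  rewrite -(@ge0_integral_dil_cell _ 1 q i
    (fun x => ((t + a i + birkhoff q (step q a) m x) ^+ 2)%:E)) //; last first.
    by move=> x _; rewrite lee_fin sqr_ge0.
  apply: eq_integral => x; rewrite inE => xc.
  by rewrite birkhoffS ?(step_cell _ q0 _ xc) ?mul1n ?addrA //; exact: cell_sub xc.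
have sq : \sum_(i < q) (t + a i) ^+ 2 = q%:R * t ^+ 2 + \sum_(i < q) a i ^+ 2.
  rewrite (eq_bigr (fun i : 'I_q => t ^+ 2 + (2 * t) * a i + a i ^+ 2)); last first.
    by move=> i _; ring.
  by rewrite !big_split /= -[X in _ + X + _]mulr_sumr a0 mulr0 addr0 sumr_const card_ord mulr_natl.
rewrite sumEFin; congr EFin; rewrite -mulr_sumr big_split /= sq sumr_const card_ord.
by rewrite -[X in _ + X](mulr_natl _ q) -natr1 /v; field.
Qed.

(** The L^1 norm is controlled by the L^2 norm through |w| <= w^2 / (2 e) + e /
    2. *)
Lemma birkhoff_norm q a m (e : R) : (0 < q)%N -> \sum_(i < q) a i = 0 -> 0 < e ->
  (0 < m)%N -> (\sum_(i < q) a i ^+ 2) / q%:R <= m%:R * e ^+ 2 ->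
  (\int[mu]_(x in I01) `|m%:R^-1 * birkhoff q (step q a) m x|%:E <= e%:E)%E.
Proof.
move=> q0 a0 e0 m0 hm; set Z := birkhoff _ _ _.
have mZ : measurable_fun I01 Z by apply: measurable_birkhoff; exact: measurable_step.
have m1 : 0 < m%:R :> R by rewrite ltr0n.
pose c : R := (2 * e * m%:R ^+ 2)^-1.
have c0 : 0 < c by rewrite invr_gt0 !mulr_gt0 // exprn_gt0.
have mlhs : measurable_fun I01 (fun x => (c%:E * ((0 + Z x) ^+ 2)%:E)%E).
  under eq_fun do rewrite -EFinM.
  apply/measurable_EFinP; apply: measurable_funM => //.
  by apply: measurable_funX; exact: measurable_funD.
have mrhs : measurable_fun I01
    (fun x => (c%:E * ((0 + Z x) ^+ 2)%:E + (e / 2)%:E)%E).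
  exact: emeasurable_funD.
apply: (@le_trans _ _ (\int[mu]_(x in I01) (c%:E * ((0 + Z x) ^+ 2)%:E + (e / 2)%:E)))%E.
  apply: ge0_le_integral => //.
  - apply/measurable_EFinP.
    by apply: (measurableT_comp (@normr_measurable R setT)); exact: measurable_funM.
  move=> x _; rewrite -EFinM -EFinD lee_fin add0r normrM ger0_norm ?invr_ge0 ?ler0n //.
  set z := Z x; rewrite -(real_normK (num_real z)); set y := `|z|.
  have -> : c * y ^+ 2 = (m%:R^-1 * y) ^+ 2 / (2 * e).
    by rewrite /c; field; rewrite !gt_eqF.
  move: (m%:R^-1 * y) => w.
  rewrite -(ler_pM2r (_ : 0 < 2 * e)) ?mulr_gt0 //.
  have -> : (w ^+ 2 / (2 * e) + e / 2) * (2 * e) = w ^+ 2 + e ^+ 2.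
    by field; rewrite gt_eqF.
  have := sqr_ge0 (w - e); rewrite sqrrB; lra.
have h1 x : I01 x -> (0 <= c%:E * ((0 + Z x) ^+ 2)%:E)%E.
  by move=> _; rewrite mule_ge0 ?lee_fin ?sqr_ge0 // ltW.
have h2 x : I01 x -> (0 <= (e / 2)%:E)%E.
  by move=> _; rewrite lee_fin divr_ge0 // ltW.
rewrite ge0_integralD //.
rewrite integral_cst //.
have -> : ((e / 2)%:E * mu I01 = (e / 2)%:E)%E by rewrite mu_I01 mule1.
have h3 x : I01 x -> (0 <= ((0 + Z x) ^+ 2)%:E)%E.
  by move=> _; rewrite lee_fin sqr_ge0.
have m3 : measurable_fun I01 (fun x => ((0 + Z x) ^+ 2)%:E).
  apply/measurable_EFinP; apply: measurable_funX; exact: measurable_funD.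
have c0' := ltW c0.
rewrite ge0_integralZl_EFin //.
rewrite birkhoff_square // expr0n add0r -EFinM -EFinD lee_fin.
set v := (_ / _) in hm *.
have -> : c * (m%:R * v) = v / (2 * e * m%:R) by rewrite /c; field; rewrite !gt_eqF.
suff : v / (2 * e * m%:R) <= e / 2 by lra.
by rewrite ler_pdivrMr ?mulr_gt0 //; move: hm; rewrite expr2; lra.
Qed.

End dense.

(** * Averages of coboundaries; density of step functions *)

Section approx.
Context (R : realType).
Local Notation mu := (@lebesgue_measure R).

(** With T the orbit starts of S_N, the average is at most 2 b |T| / |S_N| by
    telescoping, and |T| log_s N <= |S_(N^2)| <= C |S_N|; any N >= s^K with K
    >= 2 b C / eta will do. *)
Lemma coboundary_avg S C s (G : R -> R) b x eta : pos_semigroup S -> S s ->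
  (1 < s)%N ->
  (forall N, (0 < #|` trunc_set S N|)%N ->
    (#|` trunc_set S (N ^ 2)| <= C * #|` trunc_set S N|)%N) ->
  (forall y, I01 y -> `|G y| <= b) -> 0 < eta ->
  exists N0, forall N, (N0 <= N)%N ->
    `|dil_avg S (fun y => G y - G (dil s y)) N x| <= eta.
Proof.
move=> Ssg Ss s1 HC Gb eta0.
have b0 : 0 <= b by apply: le_trans (Gb _ (dil_I01 1 x)).
pose K := (Num.truncn (2 * b * C%:R / eta)).+1.
have HK : 2 * b * C%:R <= eta * K%:R.
  rewrite [leRHS]mulrC -ler_pdivrMr //; apply: ltW.
  have /truncn_itv/andP[_] : 0 <= 2 * b * C%:R / eta.
    by rewrite divr_ge0 ?mulr_ge0 // ltW.
  by [].
exists (s ^ K)%N => N sN; rewrite dil_avgE.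
have [->|N0] := posnP #|` trunc_set S N|.
  by rewrite invr0 mulr0 normr0 ltW.
rewrite normrM normfV [X in _ / X]ger0_norm ?ler0n //.
rewrite ler_pdivrMr ?ltr0n //.
have := @coboundary_sum R S s N (fun n => G (dil n x)) b Ssg Ss b0
  (fun n => Gb _ (dil_I01 n x)).
rewrite (eq_bigr (fun n => G (dil n x) - G (dil s (dil n x)))); last first.
  by move=> n _; rewrite dilM mulnC.
move=> /le_trans; apply.
have Kl : (K <= trunc_log s N)%N by apply: trunc_log_max.
have hT : (#|` orbit_starts S s N| * K <= C * #|` trunc_set S N|)%N.
  apply: leq_trans (HC _ N0); apply: leq_trans (orbit_starts_count N Ssg Ss s1).
  by rewrite leq_mul2l Kl orbT.
rewrite -(ler_pM2r (_ : 0 < K%:R)) ?ltr0n //.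
rewrite -[leLHS]mulrA -[X in _ * X <= _]natrM.
apply: (@le_trans _ _ (2 * b * (C * #|` trunc_set S N|)%:R)).
  by rewrite ler_wpM2l ?mulr_ge0 // ler_nat.
by rewrite natrM mulrA [leRHS]mulrAC ler_wpM2r.
Qed.

Lemma dil_avgD S (f g : R -> R) N x :
  dil_avg S (fun y => f y + g y) N x = dil_avg S f N x + dil_avg S g N x.
Proof. by rewrite !dil_avgE big_split mulrDl. Qed.

Lemma dil_avgZ S c (f : R -> R) N x :
  dil_avg S (fun y => c * f y) N x = c * dil_avg S f N x.
Proof. by rewrite !dil_avgE -mulr_sumr mulrA. Qed.

Lemma dil_avg_cst S (c : R) N x : (0 < #|` trunc_set S N|)%N ->
  dil_avg S (fun=> c) N x = c.
Proof.
move=> N0; rewrite dil_avgE big_const_seq count_predT iter_addr_0.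
by rewrite -[c *+ _]mulr_natr mulfK // pnatr_eq0 -lt0n.
Qed.

Lemma dil_avg_sum S (I : Type) (r : seq I) (F : I -> R -> R) N x :
  dil_avg S (fun y => \sum_(i <- r) F i y) N x =
  \sum_(i <- r) dil_avg S (F i) N x.
Proof. by rewrite dil_avgE exchange_big mulr_suml. Qed.

Lemma eventually_small_sum (I : Type) (r : seq I) (F : I -> nat -> R) :
  (forall i eta, 0 < eta -> exists N0, forall N, (N0 <= N)%N -> `|F i N| <= eta) ->
  forall eta, 0 < eta -> exists N0, forall N, (N0 <= N)%N ->
    `|\sum_(i <- r) F i N| <= eta.
Proof.
move=> H; elim: r => [|i r IH] eta eta0.
  by exists 0%N => N _; rewrite big_nil normr0 ltW.
have [N1 H1] := H i _ (divr_gt0 eta0 (ltr0n R 2)).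
have [N2 H2] := IH _ (divr_gt0 eta0 (ltr0n R 2)).
exists (maxn N1 N2) => N; rewrite geq_max => /andP[h1 h2]; rewrite big_cons.
apply: le_trans (ler_normD _ _) _.
by have := H1 _ h1; have := H2 _ h2; lra.
Qed.

(** Approximate f in L^1 by a continuous function, and that one by its values
    at the left ends of the cells of base s^(k+1), using dominated
    convergence. *)
Lemma step_approx (s : nat) (f : R -> R) (e : R) : (1 < s)%N -> 0 < e ->
  mu.-integrable I01 (EFin \o f) ->
  exists k a, (\int[mu]_(x in I01) `|f x - step (s ^ k.+1) a x|%:E <= e%:E)%E.
Proof.
move=> s1 e0 intf.
have [phi_ [phic phii phil]] :=
  @approximation_continuous_integrable R I01 f measurable_I01
    (eq_ind_r (fun z => (z < +oo)%E) (ltry 1) (mu_I01 R)) intf.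
have e2 : (0 < (e / 2)%:E)%E by rewrite lte_fin divr_gt0.
have [n0 _ Hn0] := phil _ (open_ereal_lt' e2).
pose phi := phi_ n0; have phi_cont : continuous phi := phic n0.
have hphi : (\int[mu]_(x in I01) `|f x - phi x|%:E < (e / 2)%:E)%E.
  exact: (Hn0 n0 (leqnn _)).
have mphi : measurable_fun I01 phi.
  by apply: measurable_funTS; exact: continuous_measurable_fun.
have mf : measurable_fun I01 f.
  by have /integrableP[/measurable_EFinP] := intf.
have [M HM] : exists M, forall x, x \in `[0, 1] -> `|phi x| <= M.
  have [c _ Hc] := @EVT_max R (fun x => `|phi x|) 0 1 ler01
    (continuous_subspaceT (fun x => continuous_comp (@phi_cont x) (@norm_continuous _ R (phi x)))).
  by exists (`|phi c|).
pose q k := (s ^ k.+1)%N; pose a k i := phi (i%:R / (q k)%:R).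
have q0 k : (0 < q k)%N by rewrite expn_gt0 ltnW.
have qk k : (k < q k)%N by apply: ltn_trans (ltn_expl k s1) _; rewrite ltn_exp2l.
have pt k (x : R) : I01 x ->
    (Num.truncn ((q k)%:R * x))%:R / (q k)%:R \in `[0 : R, 1].
  move=> xI; rewrite in_itv /=; apply/andP; split; first by rewrite divr_ge0.
  rewrite ler_pdivrMr ?ltr0n // mul1r ler_nat.
  by rewrite ltnW // truncn_lt.
have cvgp (x : R) : I01 x ->
    (Num.truncn ((q k)%:R * x))%:R / (q k)%:R @[k --> \oo] --> x.
  move=> xI; have x0 : 0 <= x by move: xI; rewrite I01E => /andP[].
  apply/cvgrPdist_le => eps eps0; near=> k.
  have qp : 0 < (q k)%:R :> R by rewrite ltr0n.
  have /truncn_itv/andP[h1 h2] : 0 <= (q k)%:R * x by rewrite mulr_ge0.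
  set t := Num.truncn _ in h1 h2 *.
  have -> : x - t%:R / (q k)%:R = ((q k)%:R * x - t%:R) / (q k)%:R.
    by field; rewrite gt_eqF.
  rewrite normrM normfV (ger0_norm (ltW qp)) ger0_norm ?subr_ge0 //.
  rewrite ler_pdivrMr //; apply: (@le_trans _ _ 1).
    by move: h2; rewrite -natr1; lra.
  have : eps^-1 <= (q k)%:R.
    apply: (@le_trans _ _ k%:R); last by rewrite ler_nat ltnW.
    near: k; exact: nbhs_infty_ger.
  by rewrite -(ler_pM2l eps0) mulfV // gt_eqF.
pose F k : measurableTypeR R -> \bar R := EFin \o step (q k) (a k).
have mF k : measurable_fun I01 (F k).
  by apply/measurable_EFinP; exact: measurable_step.
have mphi' : measurable_fun I01 (EFin \o phi) by exact/measurable_EFinP.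
have cF : {ae mu, forall x, I01 x -> F^~ x @ \oo --> (EFin \o phi) x}.
  apply: aeW => x xI; apply: cvg_EFin; first exact: nearW.
  apply: (@continuous_cvg _ _ _ _ _ _ phi); first exact: phi_cont.
  exact: cvgp.
have iM : mu.-integrable I01 (EFin \o cst M).
  apply: measurable_bounded_integrable => //.
    by suff : (mu I01 < +oo)%E by []; rewrite mu_I01 ltry.
  by exists `|M|; split; [exact: num_real|move=> t /ltW h y _].
have dF : {ae mu, forall x n, I01 x -> (`|F n x| <= (EFin \o cst M) x)%E}.
  apply: aeW => x n xI; rewrite /F /= lee_fin; apply: HM; exact: pt.
have [_ dct _] := dominated_convergence measurable_I01 mF mphi' cF iM dF.
have [k0 _ Hk0] := dct _ (open_ereal_lt' e2).
exists k0, (a k0).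
have hk := Hk0 k0 (leqnn _).
have mstep : measurable_fun I01 (step (q k0) (a k0)) by exact: measurable_step.
have m1 : measurable_fun I01 (fun x => `|f x - phi x|%:E).
  by apply/measurable_EFinP; exact: measurable_norm_dist.
have m2 : measurable_fun I01 (fun x => `|phi x - step (q k0) (a k0) x|%:E).
  by apply/measurable_EFinP; exact: measurable_norm_dist.
have m3 : measurable_fun I01 (fun x => `|f x - step (q k0) (a k0) x|%:E).
  by apply/measurable_EFinP; exact: measurable_norm_dist.
apply: (@le_trans _ _ (\int[mu]_(x in I01)
   (`|f x - phi x|%:E + `|phi x - step (q k0) (a k0) x|%:E))%E).
  apply: ge0_le_integral => //; first exact: emeasurable_funD.
  by move=> x _; rewrite -EFinD lee_fin; exact: ler_distD.
rewrite ge0_integralD //.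
apply: (@le_trans _ _ ((e / 2)%:E + (e / 2)%:E)%E); last first.
  by rewrite -EFinD lee_fin; lra.
apply: leeD; first exact: ltW.
apply: le_trans (ltW hk); rewrite le_eqVlt; apply/orP; left; apply/eqP.
by apply: eq_integral => x _; rewrite /F /= distrC.
Unshelve. all: end_near.
Qed.

End approx.

(** * Almost everywhere convergence *)

Lemma expn_gt1 j q : (1 < q)%N -> (1 < q ^ j.+1)%N.
Proof. by move=> q1; rewrite -[ltnLHS](exp1n j.+1) ltn_exp2r. Qed.

Section positive.
Context (R : realType).
Local Notation mu := (@lebesgue_measure R).

Lemma semigroupX S s k : pos_semigroup S -> S s -> S (s ^ k.+1)%N.
Proof.
move=> [_ SM] Ss; elim: k => [|k IH]; first by rewrite expn1.
by rewrite expnS; exact: SM.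
Qed.

(** Let c + g0 be a step function in base q = s^(k+1), close to f, with g0 of
    mean zero. Then h = c + (1/m) sum_(j < m) (g0 - g0 (q^(j+1) x)) has
    averages tending to c, and it differs from the step function by the mean of
    g0 over the digits 2 to m+1, which is small in L^1 for m large. *)
Lemma good_approx S C s (f : R -> R) (e : R) : pos_semigroup S -> S s ->
  (1 < s)%N ->
  (forall N, (0 < #|` trunc_set S N|)%N ->
    (#|` trunc_set S (N ^ 2)| <= C * #|` trunc_set S N|)%N) ->
  mu.-integrable I01 (EFin \o f) -> 0 < e ->
  exists (h : R -> R) (c : R), [/\ measurable_fun I01 h,
    (\int[mu]_(x in I01) `|f x - h x|%:E <= e%:E)%E,
    `|c - \int[mu]_(x in I01) f x| <= e &
    forall x eta : R, 0 < eta -> exists N0, forall N, (N0 <= N)%N ->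
      `|dil_avg S h N x - c| <= eta].
Proof.
move=> Ssg Ss s1 HC intf e0; have [Spos _] := Ssg.
have e2 : 0 < e / 2 by rewrite divr_gt0.
have [k [a fa]] := step_approx s1 e2 intf.
pose q := (s ^ k.+1)%N; rewrite -/q in fa.
have q1 : (1 < q)%N by exact: expn_gt1.
have q0 : (0 < q)%N by rewrite ltnW.
have qR : q%:R != 0 :> R by rewrite pnatr_eq0 -lt0n.
have Sq : S q by exact: semigroupX.
pose c := (\sum_(i < q) a i) / q%:R.
pose a' i := a i - c; pose g0 := step q a'.
have a'0 : \sum_(i < q) a' i = 0.
  rewrite sumrB sumr_const card_ord -[X in _ - X]mulr_natr /c.
  by rewrite mulfVK // subrr.
pose v := (\sum_(i < q) a' i ^+ 2) / q%:R.
have v0 : 0 <= v by rewrite divr_ge0 // sumr_ge0 // => i _; rewrite sqr_ge0.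
pose m := (Num.truncn (v / (e / 2) ^+ 2)).+1.
have m0 : (0 < m)%N by [].
have mR : m%:R != 0 :> R by rewrite pnatr_eq0.
have hm : v <= m%:R * (e / 2) ^+ 2.
  rewrite -ler_pdivrMr ?exprn_gt0 //; apply: ltW.
  by have /truncn_itv/andP[] : 0 <= v / (e / 2) ^+ 2 by rewrite divr_ge0 ?sqr_ge0.
pose h y := c + m%:R^-1 * \sum_(j < m) (g0 y - g0 (dil (q ^ j.+1) y)).
have hE y : h y = step q a y - m%:R^-1 * birkhoff q g0 m (dil q y).
  rewrite /h sumrB sumr_const card_ord -[X in X - _]mulr_natl mulrBr mulKf //.
  have -> : step q a y = c + g0 y by rewrite /g0 /step /a' addrC subrK.
  rewrite addrA; congr (_ - _ * _); apply: eq_bigr => j _.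
  by rewrite dilM -expnSr.
have mstep : measurable_fun I01 (step q a) by exact: measurable_step.
have mg0 : measurable_fun I01 g0 by exact: measurable_step.
have mbir : measurable_fun I01 (fun y => m%:R^-1 * birkhoff q g0 m y).
  by apply: measurable_funM => //; exact: measurable_birkhoff.
have mh : measurable_fun I01 h.
  rewrite (_ : h = fun y => step q a y - m%:R^-1 * birkhoff q g0 m (dil q y)).
    apply: measurable_funB => //.
    exact: (measurable_comp_dil (f := fun y => m%:R^-1 * birkhoff q g0 m y)).
  exact/funext.
have mf : measurable_fun I01 f by have /integrableP[/measurable_EFinP] := intf.
exists h, c; split=> //.
- have m1 : measurable_fun I01 (fun x => `|f x - step q a x|%:E).
    by apply/measurable_EFinP; exact: measurable_norm_dist.
  have m2' : measurable_fun I01 (fun x => `|m%:R^-1 * birkhoff q g0 m x|%:E).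
    by apply/measurable_EFinP; exact: (measurableT_comp (@normr_measurable R setT)).
  have m2 : measurable_fun I01 (fun x => `|m%:R^-1 * birkhoff q g0 m (dil q x)|%:E).
    apply/measurable_EFinP.
    apply: (measurable_comp_dil (f := fun x => `|m%:R^-1 * birkhoff q g0 m x|)).
    exact/measurable_EFinP.
  have m3 : measurable_fun I01 (fun x => `|f x - h x|%:E).
    by apply/measurable_EFinP; exact: measurable_norm_dist.
  apply: (@le_trans _ _ (\int[mu]_(x in I01)
     (`|f x - step q a x|%:E + `|m%:R^-1 * birkhoff q g0 m (dil q x)|%:E))%E).
    apply: ge0_le_integral => //; first exact: emeasurable_funD.
    move=> x _; rewrite -EFinD lee_fin hE opprB addrCA [X in `|X|]addrC.
    exact: ler_normD.
  rewrite ge0_integralD //.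
  rewrite (@ge0_integral_dil_I01 _ q (fun x => `|m%:R^-1 * birkhoff q g0 m x|%:E)) //.
  apply: (@le_trans _ _ ((e / 2)%:E + (e / 2)%:E)%E); last first.
    by rewrite -EFinD lee_fin; lra.
  by apply: leeD => //; exact: birkhoff_norm.
- have ig : mu.-integrable I01 (EFin \o step q a) by exact: integrable_step.
  rewrite /c -(Rintegral_step a q0) -RintegralB //.
  apply: le_trans (le_normr_Rintegral _ _) _ => //.
    by apply: (@integrableB _ _ _ mu I01 _ (EFin \o step q a) (EFin \o f)).
  rewrite -lee_fin /Rintegral.
  have le2 : (\int[mu]_(x in I01) `|step q a x - f x|%:E <= e%:E)%E.
    apply: (@le_trans _ _ (e / 2)%:E); last by rewrite lee_fin; lra.
    by under eq_integral do rewrite distrC.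
  rewrite fineK // ge0_fin_numE ?integral_ge0 //.
  exact: le_lt_trans le2 (ltry _).
move=> x eta eta0.
have bnd y : I01 y -> `|g0 y| <= \sum_(i < q) `|a' i| by exact: step_bounded.
have [N1 H1] := @eventually_small_sum _ _ (index_enum 'I_m)
  (fun j N => dil_avg S (fun y => g0 y - g0 (dil (q ^ j.+1) y)) N x)
  (fun j eta' eta0' => coboundary_avg x Ssg (semigroupX j Ssg Sq)
     (expn_gt1 j q1) HC bnd eta0') eta eta0.
exists (maxn N1 s) => N; rewrite geq_max => /andP[N1N sN].
have N0 : (0 < #|` trunc_set S N|)%N.
  by rewrite cardfs_gt0; apply/fset0Pn; exists s; apply/trunc_setP.
rewrite dil_avgD dil_avg_cst // addrC addKr dil_avgZ.
rewrite [X in _ * X](_ : _ = \sum_(j < m)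
    dil_avg S (fun y => g0 y - g0 (dil (q ^ j.+1) y)) N x); last exact: dil_avg_sum.
rewrite normrM; apply: le_trans (H1 _ N1N).
by rewrite ler_piMl // ger0_norm ?invr_ge0 // invf_le1 ?ltr0n // ler1n.
Qed.


Lemma measure_bigcup_le (E : nat -> set (measurableTypeR R)) (r : \bar R) :
  (forall n, measurable (E n)) -> {homo E : m n / (m <= n)%N >-> (m `<=` n)%classic} ->
  (forall n, mu (E n) <= r)%E -> (mu (\bigcup_n E n) <= r)%E.
Proof.
move=> mE hE Er.
have cvgE : mu (E n) @[n --> \oo] --> mu (\bigcup_n E n).
  apply: nondecreasing_cvg_mu => //; first exact: bigcup_measurable.
  by move=> m n mn; apply/subsetPset; exact: hE.
rewrite -(cvg_lim _ cvgE) //; apply: lime_le; last exact: nearW.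
by apply/cvg_ex; eexists; exact: cvgE.
Qed.

Lemma maximal_union S C (f : R -> R) (lam : R) : pos_semigroup S ->
  (forall N, (0 < #|` trunc_set S N|)%N ->
    (#|` trunc_set S (N ^ 2)| <= C * #|` trunc_set S N|)%N /\
    tempelman S C N) ->
  measurable_fun I01 f -> (forall x, I01 x -> 0 <= f x) -> 0 < lam ->
  (mu (\bigcup_J max_avg_set S f lam J) <=
    (lam^-1 * (C * C)%:R)%:E * \int[mu]_(x in I01) (f x)%:E)%E.
Proof.
move=> Ssg HC mf f0 lam0; apply: measure_bigcup_le.
- by move=> J; exact: measurable_max_avg_set.
- move=> J K JK x [xI [N NJ h]]; split=> //; exists N => //.
  exact: leq_trans JK.
move=> J; have := dil_maximal_inequality J Ssg HC mf f0 lam0.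
rewrite -(@lee_pmul2l _ (lam^-1)%:E) ?lte_fin ?invr_gt0 // !muleA -!EFinM.
by rewrite mulVf ?gt_eqF // mul1e.
Qed.

(** Banach's principle. If h is close to f in L^1 and its averages converge to
    a constant close to the integral of f, the averages of f can stay away from
    their expected limit only where the maximal function of |f - h| is large, a
    set of measure proportional to the distance of f and h. *)
Lemma positive_direction S B (f : R -> R) : pos_semigroup S -> infinite_set S ->
  primes_le S B ->
  mu.-integrable I01 (EFin \o f) ->
  {ae mu, forall x, I01 x -> dil_avg S f N x @[N --> \oo] -->
     \int[mu]_(y in I01) f y}.
Proof.
move=> Ssg Sinf SB intf; have [Spos _] := Ssg.
have [C C0 HC] := semigroup_doubling Ssg SB.
have HC' N (N0 : (0 < #|` trunc_set S N|)%N) := (HC N N0).1.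
have [s [Ss s1]] : exists s, S s /\ (1 < s)%N.
  apply: contrapT => H; apply: Sinf.
  apply: (@sub_finite_set _ _ `I_2); last exact: finite_II.
  by move=> n Sn /=; rewrite ltnNge; apply/negP => n1; apply: H; exists n.
set If := \int[mu]_(y in I01) f y.
pose Bad (d : R) : set (measurableTypeR R) := [set x | I01 x /\
  ~ exists N0, forall N, (N0 <= N)%N -> `|dil_avg S f N x - If| <= d].
have badN d : 0 < d -> mu.-negligible (Bad d).
  move=> d0; pose lam := d / 3; have lam0 : 0 < lam by rewrite divr_gt0.
  pose K : R := (C * C).+1%:R; have K0 : 0 < K by rewrite ltr0n.
  pose e n : R := lam / K / n.+1%:R.
  have e0 n : 0 < e n by rewrite !divr_gt0.
  have el n : e n <= lam.
    rewrite /e -mulrA ler_piMr ?(ltW lam0) // -invfM invf_le1 ?mulr_gt0 ?ltr0n //.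
    by rewrite -natrM ler1n muln_gt0.
  have /choice[h /choice[c Hh]] : forall n, exists (h : R -> R) (c : R), [/\
      measurable_fun I01 h,
      (\int[mu]_(x in I01) `|f x - h x|%:E <= (e n)%:E)%E, `|c - If| <= e n &
      forall x eta : R, 0 < eta -> exists N0, forall N, (N0 <= N)%N ->
      `|dil_avg S h N x - c| <= eta].
    by move=> n; exact: (good_approx Ssg Ss s1 HC' intf (e0 n)).
  have mf : measurable_fun I01 f by have /integrableP[/measurable_EFinP] := intf.
  pose E n := \bigcup_J max_avg_set S (fun x => `|f x - h n x|) lam J.
  have mfh n : measurable_fun I01 (fun x => `|f x - h n x|).
    by apply: measurable_norm_dist => //; have [] := Hh n.
  have mE n : measurable (E n).
    by apply: bigcup_measurable => J _; exact: measurable_max_avg_set.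
  have muE n : (mu (E n) <= (n.+1%:R^-1)%:E)%E.
    have [_ hi _ _] := Hh n.
    apply: le_trans (maximal_union Ssg HC (mfh n) _ lam0) _ => //.
    apply: (@le_trans _ _ ((lam^-1 * (C * C)%:R)%:E * (e n)%:E)%E).
      by apply: lee_wpmul2l => //; rewrite lee_fin mulr_ge0 // invr_ge0 ltW.
    rewrite -EFinM lee_fin /e.
    have -> : lam^-1 * (C * C)%:R * (lam / K / n.+1%:R) = ((C * C)%:R / K) / n.+1%:R.
      have gen (u v w z : R) : u != 0 -> v != 0 -> w != 0 ->
        u^-1 * z * (u / v / w) = z / v / w by move=> *; field; apply/and3P.
      by apply: gen; rewrite ?pnatr_eq0 // gt_eqF.
    by rewrite ler_piMl ?invr_ge0 // ler_pdivrMr // mul1r ler_nat.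
  have BadE n : Bad d `<=` E n.
    move=> x [xI nex]; apply: contrapT => nE; apply: nex.
    have [_ _ hc hcv] := Hh n.
    have [N0 HN0] := hcv x _ lam0; exists N0 => N N0N.
    have lef : `|dil_avg S f N x - dil_avg S (h n) N x| <= lam.
      rewrite leNgt; apply/negP => lt; apply: nE; exists N => //; split=> //.
      exists N => //; apply: lt_le_trans lt _.
      rewrite !dil_avgE -mulrBl -sumrB normrM normfV (ger0_norm (ler0n _ _)).
      by rewrite ler_wpM2r ?invr_ge0 // ler_norm_sum.
    have := HN0 _ N0N; have := le_trans hc (el n); move: lef.
    set u := dil_avg S f N x; set w := dil_avg S (h n) N x.
    move=> h1 h2 h3.
    have -> : u - If = (u - w) + (w - c n) + (c n - If) by ring.
    apply: le_trans (ler_normD _ _) _.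
    have := ler_normD (u - w) (w - c n).
    have -> : d = lam + lam + lam by rewrite /lam; field.
    by move: h1 h2 h3; lra.
  exists (\bigcap_n E n); split.
  - exact: bigcap_measurable.
  - apply/eqP; rewrite eq_le measure_ge0 andbT; apply/lee_addgt0Pr => r r0.
    rewrite add0e; pose n := Num.truncn r^-1.
    apply: (@le_trans _ _ (mu (E n))).
      by rewrite le_measure ?inE //; [exact: bigcap_measurable|exact: bigcap_inf].
    apply: le_trans (muE n) _; rewrite lee_fin.
    rewrite -[leRHS]invrK lef_pV2 ?posrE ?ltr0n ?invr_gt0 //.
    by have /truncn_itv/andP[_ /ltW] : 0 <= r^-1 by rewrite invr_ge0 ltW.
  by move=> x Bx n _; exact: BadE.
have : mu.-negligible (\bigcup_k Bad (k.+1%:R^-1)).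
  by apply: negligible_bigcup => k; apply: badN; rewrite invr_gt0.
apply: negligibleS => x /= nx; apply: contrapT => nB; apply: nx => xI.
apply/cvgrPdist_le => eps eps0; pose k := Num.truncn eps^-1.
have ke : k.+1%:R^-1 <= eps.
  rewrite -[leRHS]invrK lef_pV2 ?posrE ?ltr0n ?invr_gt0 //.
  by have /truncn_itv/andP[_ /ltW] : 0 <= eps^-1 by rewrite invr_ge0 ltW.
have [N0 HN0] : exists N0, forall N, (N0 <= N)%N ->
    `|dil_avg S f N x - If| <= k.+1%:R^-1.
  by apply: contrapT => H; apply: nB; exists k.
exists N0 => // N /= N0N; rewrite distrC; apply: le_trans ke; exact: HN0.
Qed.

End positive.

(** * Grids and towers *)

Section tower.
Context (R : realType).
Local Notation mu := (@lebesgue_measure R).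
Local Notation setR := (set (measurableTypeR R)).

(** The part of U in [0, 1) is a union of cells of base p. *)
Definition grid p (U : setR) :=
  forall i x y, (i < p)%N -> cell p i x -> cell p i y -> U x -> U y.

Lemma gridC p U : grid p U -> grid p (~` U).
Proof. by move=> gU i x y ip xc yc nUx Uy; apply: nUx; exact: (gU _ _ _ ip yc xc Uy). Qed.

Lemma gridU p U V : grid p U -> grid p V -> grid p (U `|` V).
Proof.
move=> gU gV i x y ip xc yc [Ux|Vx]; [left; exact: (gU _ _ _ ip xc yc Ux)|right; exact: (gV _ _ _ ip xc yc Vx)].
Qed.

Lemma gridI p U V : grid p U -> grid p V -> grid p (U `&` V).
Proof. by move=> gU gV i x y ip xc yc [Ux Vx]; split; [exact: (gU _ _ _ ip xc yc Ux)|exact: (gV _ _ _ ip xc yc Vx)]. Qed.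

Lemma grid_I01 p : (0 < p)%N -> grid p I01.
Proof. by move=> p0 i x y ip _ yc _; exact: cell_sub yc. Qed.

Lemma cell_inj q i j (x : R) : (0 < q)%N -> cell q i x -> cell q j x -> i = j.
Proof.
move=> q0; rewrite !cellE // => /andP[h1 h2] /andP[h3 h4].
have : (i < j.+1)%N by rewrite -(ltr_nat R) (le_lt_trans h1).
have : (j < i.+1)%N by rewrite -(ltr_nat R) (le_lt_trans h3).
lia.
Qed.

Lemma grid_cell q i : (0 < q)%N -> grid q (cell q i).
Proof. by move=> q0 j x y jq xc yc xi; rewrite -(cell_inj q0 xc xi). Qed.

Lemma grid_refine k p U : (0 < k)%N -> (0 < p)%N -> grid p U -> grid (k * p) U.
Proof.
move=> k0 p0 gU i x y ip.
have kp0 : (0 < k * p)%N by rewrite muln_gt0 k0.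
have sub (z : R) : cell (k * p) i z -> cell p (i %/ k) z.
  rewrite !cellE // natrM -mulrA; set w := p%:R * z => /andP[h1 h2].
  have kR : 0 < k%:R :> R by rewrite ltr0n.
  apply/andP; split.
    rewrite -(ler_pM2l kR) -natrM; apply: le_trans h1; rewrite ler_nat mulnC.
    exact: leq_trunc_div.
  rewrite -(ltr_pM2l kR) -natrM; apply: (lt_le_trans h2); rewrite ler_nat mulnC.
  by rewrite ltn_ceil.
move=> /sub xc /sub yc; apply: (gU _ _ _ _ xc yc).
by rewrite ltn_divLR // mulnC.
Qed.

Lemma grid_dil n p U : (0 < n)%N -> (0 < p)%N -> grid p U ->
  grid (n * p) (dil n @^-1` U).
Proof.
move=> n0 p0 gU i x y ip.
have np0 : (0 < n * p)%N by rewrite muln_gt0 n0.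
have pR : 0 < p%:R :> R by rewrite ltr0n.
have sub (z : R) : cell (n * p) i z -> cell p (i %% p) (dil n z).
  rewrite !cellE // natrM mulrAC -mulrC => /andP[h1 h2].
  have iE : i%:R = (i %/ p)%:R * p%:R + (i %% p)%:R :> R.
    by rewrite -natrM -natrD -divn_eq.
  have ip1 : (i %% p).+1%:R <= p%:R :> R by rewrite ler_nat ltn_mod.
  have zc : cell n (i %/ p) z.
    rewrite cellE //; apply/andP; split.
      rewrite -(ler_pM2l pR); apply: le_trans h1; rewrite iE mulrC lerDl.
      exact: ler0n.
    rewrite -(ltr_pM2l pR); apply: (lt_le_trans h2).
    move: ip1; rewrite -[in i.+1%:R]natr1 iE -!natr1 mulrDr mulr1 => ip1.
    by rewrite -addrA [leRHS]addrC mulrC; lra.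
  rewrite (dil_cell n0 zc) mulrBr; move: h1 h2; rewrite -!natr1 iE.
  move: (p%:R * (n%:R * z)) => w; rewrite mulrC => h1 h2.
  by apply/andP; split; lra.
move=> /sub xc /sub yc; apply: (gU _ _ _ _ xc yc).
by rewrite ltn_mod.
Qed.

Local Open Scope ereal_scope.

(** On each cell of base p, where U is all or nothing, dilation by p spreads
    the preimage of V evenly. *)
Lemma grid_indep p U V : (0 < p)%N -> measurable U -> measurable V -> grid p U ->
  mu (I01 `&` (U `&` dil p @^-1` V)) = mu (I01 `&` U) * mu (I01 `&` V).
Proof.
move=> p0 mU mV gU.
have mW : measurable (U `&` dil p @^-1` V).
  by apply: measurableI => //; exact: measurable_dil_preimage.
rewrite (measure_cells p0) // [X in _ = X * _](measure_cells p0) //.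
rewrite ge0_sume_distrl //; apply: eq_bigr => i _.
have [[x [xc Ux]]|nx] := pselect (exists x, cell p i x /\ U x).
  have cU : cell p i `<=` U by move=> y yc; exact: (gU _ _ _ (ltn_ord i) xc yc Ux).
  rewrite setIA (setIidl cU) cell_dil //; congr (_ * _).
  by rewrite mu_cell.
have c0 : cell p i `&` U = set0.
  by apply/seteqP; split=> // x [xc Ux]; apply: nx; exists x.
by rewrite setIA c0 set0I measure0 mul0e.
Qed.

(** The m-th level of a tower over one cell of base Q = Mx^2 + Mx + 1: if n
    divides m, then dilation by n maps the level m into the level m / n. The
    position of the cell serves to make the levels m <= Mx disjoint. *)
Definition tower Mx m : setR := I01 `&` dil m @^-1` (cell (Mx ^ 2 + Mx + 1)%N Mx).

Lemma tower_modulus_gt0 Mx : (0 < Mx ^ 2 + Mx + 1)%N.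
Proof. by rewrite addn1. Qed.

Lemma measurable_tower Mx m : measurable (tower Mx m).
Proof. apply: measurableI => //; apply: measurable_dil_preimage.
exact: measurable_cell.
Qed.

Lemma mu_tower Mx m : (0 < m)%N ->
  mu (tower Mx m) = ((Mx ^ 2 + Mx + 1)%N%:R^-1)%:E.
Proof.
move=> m0; rewrite /tower measure_dil //; last exact: measurable_cell.
rewrite setIidr ?mu_cell ?tower_modulus_gt0 //.
by apply: cell_sub; rewrite addn1 ltnS leq_addl.
Qed.

(** If m x = a + u and m' x = a' + u' with a, a' integers and u, u' in the
    cell, then m' u - m u' = m a' - m' a is an integer. But u and u' lie
    between Mx / Q and (Mx + 1) / Q, so for m < m' <= Mx the number Q (m' u - m
    u') exceeds m' Mx - m (Mx + 1) >= 0 and is less than m' (Mx + 1) - m Mx <=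
    Q - 1. *)
Lemma tower_disjoint Mx m m' x : (0 < m)%N -> (m < m')%N -> (m' <= Mx)%N ->
  tower Mx m x -> tower Mx m' x -> False.
Proof.
move=> m0 mm' m'M [xI h] [_ h'].
set Q := (Mx ^ 2 + Mx + 1)%N in h h'.
have Q0 : (0 < Q)%N by rewrite /Q addn1.
move: h h'; rewrite /preimage /= !cellE // /dil /Defs.frac.
move: (Num.floor (m%:R * x)) (Num.floor (m'%:R * x)) => a a'.
rewrite -!natr1 => /andP[h1 h2] /andP[h3 h4].
(* the integer m a' - m' a would lie strictly between 0 and 1 *)
pose k : int := (m : int) * a' - (m' : int) * a.
have kE : (k%:~R = m%:R * a'%:~R - m'%:R * a%:~R :> R)%R.
  by rewrite /k intrB !intrM.
have mR : (0 < m%:R :> R)%R by rewrite ltr0n.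
have m'R : (0 < m'%:R :> R)%R by rewrite ltr0n (ltn_trans m0).
have mm'R : (m%:R + 1 <= m'%:R :> R)%R by rewrite natr1 ler_nat.
have m'MR : (m'%:R <= Mx%:R :> R)%R by rewrite ler_nat.
have QR : Q%:R = (Mx%:R ^+ 2 + Mx%:R + 1 :> R)%R by rewrite /Q !natrD natrX.
have QR0 : (0 < Q%:R :> R)%R by rewrite ltr0n.
have l1 : (m'%:R * Mx%:R <= m'%:R * (Q%:R * (m%:R * x - a%:~R)) :> R)%R.
  by rewrite ler_pM2l.
have l2 : (m'%:R * (Q%:R * (m%:R * x - a%:~R)) < m'%:R * (Mx%:R + 1) :> R)%R.
  by rewrite ltr_pM2l.
have l3 : (m%:R * Mx%:R <= m%:R * (Q%:R * (m'%:R * x - a'%:~R)) :> R)%R.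
  by rewrite ler_pM2l.
have l4 : (m%:R * (Q%:R * (m'%:R * x - a'%:~R)) < m%:R * (Mx%:R + 1) :> R)%R.
  by rewrite ltr_pM2l.
have e : (m'%:R * (Q%:R * (m%:R * x - a%:~R)) - m%:R * (Q%:R * (m'%:R * x - a'%:~R))
   = Q%:R * k%:~R :> R)%R by rewrite kE; ring.
have k0 : (0 < k%:~R :> R)%R.
  rewrite -(pmulr_rgt0 _ QR0) -e.
  have : (m%:R * (Mx%:R + 1) <= m'%:R * Mx%:R :> R)%R by nra.
  by move: l1 l4; lra.
have k1 : (k%:~R < 1 :> R)%R.
  rewrite -(ltr_pM2l QR0) -e mulr1.
  have : (m'%:R * (Mx%:R + 1) - m%:R * Mx%:R <= Q%:R - 1 :> R)%R by rewrite QR; nra.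
  by move: l2 l3; lra.
by move: k0 k1; rewrite ltr0z ltrz1 gtz0_ge1 leNgt => /negP.
Qed.

End tower.

(** * Small sets swept by the averages *)

Section sweep.
Context (R : realType).
Local Notation mu := (@lebesgue_measure R).
Local Notation setR := (set (measurableTypeR R)).

(** F and G are the unions of the levels in L0 and L1 of [tower_sets]; their
    measures are proportional to |L0| and |L1|, and an average at a point of
    level m counts the n in S_N that bring it to a level m / n in L0. The index
    p is a common base of all levels. *)
Lemma tower_pair S I : pos_semigroup S -> (0 < I)%N ->
  unbounded_primes S ->
  exists (F G : setR) (f g : R) p,
    [/\ [/\ (0 < p)%N, grid p G, measurable F & measurable G],
        [/\ mu (I01 `&` F) = f%:E, mu (I01 `&` G) = g%:E, 0 < g & I%:R * f <= 4 * g] &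
        forall x : R, G x -> exists N, 2^-1 <= dil_avg S (\1_F : R -> R) N x].
Proof.
move=> Ssg I0 Sinf; have [L0 [L1 [L1n cL L0p L1p HL]]] := tower_sets Ssg I0 Sinf.
pose Mx := (\max_(m <- (L0 `|` L1)%fset) m)%N.
have M0 (m : nat) : m \in L0 -> (m <= Mx)%N.
  move=> mL; apply: (@leq_bigmax_seq _ _ xpredT (fun m : nat => m) m) => //.
  by rewrite inE mL.
have M1 (m : nat) : m \in L1 -> (m <= Mx)%N.
  move=> mL; apply: (@leq_bigmax_seq _ _ xpredT (fun m : nat => m) m) => //.
  by rewrite inE mL orbT.
pose Q := (Mx ^ 2 + Mx + 1)%N; have Q0 : (0 < Q)%N := tower_modulus_gt0 Mx.
pose U (L : {fset nat}) : setR := \bigcup_(m in [set` L]) (tower Mx m : setR).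
have mt m : measurable (tower Mx m : setR) by exact: measurable_tower.
have muU (L : {fset nat}) : (forall m : nat, m \in L -> (0 < m <= Mx)%N) ->
    mu (I01 `&` U L) = (#|` L|%:R / Q%:R)%:E.
  move=> HLM; rewrite setIidr; last by move=> x [m _ []].
  rewrite /U bigcup_fset measure_fbigsetU //; last first.
    move=> m m' /= mL m'L [x [xm xm']].
    have /andP[m0 mM] := HLM _ mL; have /andP[m'0 m'M] := HLM _ m'L.
    have [mm'|mm'|//] := ltngtP m m'; exfalso.
      exact: (tower_disjoint m0 mm' m'M xm xm').
    exact: (tower_disjoint m'0 mm' mM xm' xm).
  rewrite (eq_big_seq (fun=> (Q%:R^-1)%:E)); last first.
    move=> m mL; rewrite -[LHS]/(mu (tower Mx m : setR)) mu_tower //.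
    by have /andP[] := HLM _ mL.
  by rewrite sume_const_seq ?lee_fin ?invr_ge0 // -EFinM.
have mU L : measurable (U L).
  by rewrite /U bigcup_fset; apply: bigsetU_measurable.
exists (U L0), (U L1), (#|` L0|%:R / Q%:R), (#|` L1|%:R / Q%:R), (Mx`! * Q)%N.
split; [split=> //|split|].
- by rewrite muln_gt0 fact_gt0.
- move=> i x y ip xc yc [m /= mL mx]; exists m => //.
  have mM : (m %| Mx`!)%N by apply: dvdn_fact; rewrite L1p // M1.
  have gm : grid (Mx`! * Q) (tower Mx m : setR).
    rewrite -(divnK mM) -mulnA; apply: grid_refine.
    - by rewrite divn_gt0 ?L1p // dvdn_leq // fact_gt0.
    - by rewrite muln_gt0 L1p.
    apply: gridI; first by apply: grid_I01; rewrite muln_gt0 L1p.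
    by apply: grid_dil => //; [exact: L1p|exact: grid_cell].
  exact: (gm _ _ _ ip xc yc mx).
- by apply: muU => m mL; rewrite L0p // M0.
- by apply: muU => m mL; rewrite L1p // M1.
- by rewrite divr_gt0 ?ltr0n.
- by rewrite !mulrA ler_pM2r ?invr_gt0 ?ltr0n // -!natrM ler_nat.
move=> x [m /= mL [xI mx]]; have [N N0 HN] := HL _ mL; exists N.
rewrite dil_avgE ler_pdivlMr ?ltr0n //.
set A := [fset n in _ | _]%fset in HN.
apply: (@le_trans _ _ #|` A|%:R).
  rewrite -(ler_pM2l (_ : 0 < 2)) // mulrA mulfV // mul1r -natrM ler_nat.
  exact: HN.
rewrite card_fset_sum1 natr_sum big_fset /= big_mkcond /=; apply: ler_sum => n _.
rewrite indicE; case: ifP => [/andP[nm nL]|_]; last exact: ler0n.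
rewrite mem_set //; exists (m %/ n)%N => //; split; first exact: dil_I01.
by rewrite /preimage /= dilM divnK.
Qed.

Local Open Scope ereal_scope.

Lemma mu_complement (G : setR) : measurable G ->
  mu (I01 `&` G) + mu (I01 `&` ~` G) = 1.
Proof.
move=> mG; rewrite -(mu_I01 R) addeC -setDE.
by rewrite -(measureDI mu measurable_I01 mG).
Qed.

(** Each new copy of G is dilated by a base of the grid of the previous union,
    which makes the two independent; hence the measures of the complements
    multiply. *)
Lemma boost (G : setR) (g : R) p K : (0 < p)%N -> grid p G -> measurable G ->
  mu (I01 `&` G) = g%:E ->
  exists ps : seq nat, [/\ size ps = K, all (ltn 0%N) ps &
   mu (I01 `&` ~` (\big[setU/set0]_(P <- ps) dil P @^-1` G)) = ((1 - g) ^+ K)%:E].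
Proof.
move=> p0 gG mG muG.
have muGc : mu (I01 `&` ~` G) = (1 - g)%:E.
  have := mu_complement mG.
  rewrite muG; case: (mu (I01 `&` ~` G)) => [r| |] //=.
  by rewrite -EFinD => -[<-]; rewrite addrC addKr.
suff [ps [sps aps [p' [p'0 [gp' [mps Hps]]]]]] : exists ps : seq nat,
   [/\ size ps = K, all (ltn 0%N) ps & exists p', (0 < p')%N /\
   grid p' (\big[setU/set0]_(P <- ps) dil P @^-1` G : setR) /\
   measurable (\big[setU/set0]_(P <- ps) dil P @^-1` G : setR) /\
   mu (I01 `&` ~` (\big[setU/set0]_(P <- ps) dil P @^-1` G)) = ((1 - g) ^+ K)%:E].
  by exists ps.
elim: K => [|K [ps [sps aps [p' [p'0 [gp' [mps Hps]]]]]]].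
  exists [::]; split=> //; exists 1%N; split=> //; rewrite big_nil; split=> //.
  by split=> //; rewrite setC0 setIT mu_I01 expr0.
exists (p' :: ps); split; [by rewrite /= sps|by rewrite /= p'0|].
have mdG : measurable (dil p' @^-1` G : setR) by exact: measurable_dil_preimage.
exists (p' * p)%N; split; first by rewrite muln_gt0 p'0.
rewrite big_cons; split.
  by apply: gridU; [exact: grid_dil|rewrite mulnC; exact: grid_refine].
split; first exact: measurableU.
rewrite setCU setIC [X in X `&` _]setIC setIC.
have -> : ~` (dil p' @^-1` G) = dil p' @^-1` (~` G) by rewrite preimage_setC.
rewrite (grid_indep p'0) //; [|exact: measurableC|exact: measurableC|exact: gridC].
by rewrite Hps muGc -EFinM exprSr.
Qed.

(** About 1/g independent copies of G cover at least half of the circle, as (1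
    - g)^K (1 + g)^K <= 1 and (1 + g)^K >= 1 + K g >= 2. The same number of
    copies of F has total measure at most K f <= 4 K g / I <= 8 / I. Dilation
    by P commutes with the other dilations, so that averages on the copy of G
    see the copy of F. *)
Lemma sweep S (d : R) : pos_semigroup S ->
  unbounded_primes S -> (0 < d)%R ->
  exists H W : setR, [/\ measurable H, measurable W,
    mu (I01 `&` H) <= d%:E, (2^-1)%:E <= mu (I01 `&` W) &
    forall x : R, W x -> exists N, (2^-1 <= dil_avg S (\1_H : R -> R) N x)%R].
Proof.
move=> Ssg Sinf d0.
pose I := (Num.truncn (8 / d)%R).+1.
have Id : (8 / d <= I%:R :> R)%R.
  by apply: ltW; have /truncn_itv/andP[] : (0 <= 8 / d)%R by rewrite divr_ge0 // ltW.
have [F [G [f [g [p [[p0 gG mF mG] [muF muG g0 fg] HG]]]]]] :=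
  tower_pair Ssg (ltn0Sn _ : (0 < I)%N) Sinf.
pose K := (Num.truncn g^-1).+1.
have [Kl Ku] : (K%:R <= g^-1 + 1 /\ g^-1 <= K%:R :> R)%R.
  have /truncn_itv/andP[h1 h2] : (0 <= g^-1)%R by rewrite invr_ge0 ltW.
  by split; [rewrite /K -natr1; lra|exact: ltW].
have g1 : (g <= 1)%R.
  rewrite -lee_fin -muG -(mu_I01 R) le_measure ?inE //; exact: measurableI.
have [ps [sps aps Hps]] := boost K p0 gG mG muG.
pose W : setR := \big[setU/set0]_(P <- ps) dil P @^-1` G.
pose H : setR := \big[setU/set0]_(P <- ps) dil P @^-1` F.
have mW : measurable W by apply: bigsetU_measurable => P _; exact: measurable_dil_preimage.
have mH : measurable H by apply: bigsetU_measurable => P _; exact: measurable_dil_preimage.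
exists H, W; split=> //.
- apply: (@le_trans _ _ (K%:R * f)%:E).
    rewrite /H -sps; elim: ps aps {sps Hps W H mW mH} => [|P ps IH] /=.
      by move=> _; rewrite big_nil setI0 measure0 lee_fin mul0r.
    move=> /andP[P0 aps]; rewrite big_cons setIUr.
    have mdF : measurable (dil P @^-1` F : setR) by exact: measurable_dil_preimage.
    have mr : measurable (\big[setU/set0]_(P <- ps) dil P @^-1` F : setR).
      by apply: bigsetU_measurable => j _; exact: measurable_dil_preimage.
    have e : mu (I01 `&` dil P @^-1` F) = f%:E by rewrite measure_dil // muF.
    apply: (@le_trans _ _ (mu (I01 `&` dil P @^-1` F) +
        mu (I01 `&` \big[setU/set0]_(P <- ps) dil P @^-1` F))).
      by apply: measureU2; exact: measurableI.
    rewrite e -addn1 natrD mulrDl mul1r EFinD addeC.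
    by apply: leeD => //; exact: IH.
  rewrite lee_fin.
  have f0 : (0 <= f)%R by rewrite -lee_fin -muF measure_ge0.
  have I0 : (0 < I%:R :> R)%R by rewrite ltr0n.
  have Kg : (K%:R * g <= 2)%R.
    apply: (@le_trans _ _ ((g^-1 + 1) * g)%R); first by rewrite ler_wpM2r // ltW.
    by rewrite mulrDl mulVf ?gt_eqF // mul1r; lra.
  rewrite -(ler_pM2l I0).
  apply: (@le_trans _ _ 8%R).
    rewrite mulrCA; apply: (@le_trans _ _ (K%:R * (4 * g))%R).
      by rewrite ler_wpM2l.
    by rewrite mulrCA; lra.
  by rewrite -ler_pdivrMr.
- have mWc : measurable (I01 `&` ~` W : setR) by apply: measurableI => //; exact: measurableC.
  have := mu_complement mW.
  have small : ((1 - g) ^+ K <= 2^-1)%R.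
    have b : (forall n, 1 + n%:R * g <= (1 + g) ^+ n)%R.
      elim=> [|n IH]; first by rewrite mul0r addr0 expr0.
      rewrite exprS -natr1.
      apply: (@le_trans _ _ ((1 + g) * (1 + n%:R * g))%R); last by rewrite ler_wpM2l; lra.
      have : (0 <= n%:R * g * g)%R by rewrite !mulr_ge0 // ltW.
      by lra.
    have K1 : (1 <= K%:R * g)%R by rewrite -ler_pdivrMr // mul1r.
    have pr : ((1 - g) ^+ K * (1 + g) ^+ K <= 1)%R.
      rewrite -exprMn exprn_ile1 //; last by nra.
      by rewrite mulr_ge0 //; lra.
    have q0 : (0 <= (1 - g) ^+ K)%R by rewrite exprn_ge0 //; lra.
    have := b K; nra.
  rewrite Hps; case: (mu (I01 `&` W)) => [r| |] //=.
  by rewrite -EFinD => -[]; rewrite lee_fin; lra.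
move=> x; rewrite /W -bigcup_seq => -[P /= Pps Gx].
have [N HN] := HG _ Gx; exists N; apply: le_trans HN _.
rewrite !dil_avgE ler_wpM2r ?invr_ge0 //; apply: ler_sum => n _.
rewrite !indicE; case: (asboolP (F (dil n (dil P x)))) => h; last by rewrite memNset.
rewrite mem_set // mem_set //; rewrite /H -bigcup_seq; exists P => //.
by rewrite /preimage /= dilM mulnC -dilM.
Qed.

End sweep.

(** * Divergence, and the characterization *)

Section negative.
Context (R : realType).
Local Notation mu := (@lebesgue_measure R).
Local Notation setR := (set (measurableTypeR R)).

(** Sum 2^l times the indicator of H_l, with mu H_l <= 4^-l: the sum f is
    integrable, and wherever W_l occurs infinitely often, a set of measure at
    least 1/2, its averages reach 2^l / 2 for infinitely many l. The series
    may diverge on a null set, so the points whose orbit meets that set are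
    discarded. *)
Lemma negative_direction S : pos_semigroup S ->
  unbounded_primes S ->
  ~ (forall f : R -> R, mu.-integrable I01 (EFin \o f) ->
     {ae mu, forall x : R, I01 x -> cvgn (fun N => dil_avg S f N x)}).
Proof.
move=> Ssg Sinf conv.
have /choice[H /choice[W HW]] : forall l, exists H W : setR,
   [/\ measurable H, measurable W,
    (mu (I01 `&` H) <= ((2 ^+ l * 2 ^+ l)^-1)%:E)%E,
    ((2^-1)%:E <= mu (I01 `&` W))%E &
    forall x : R, W x -> exists N, 2^-1 <= dil_avg S (\1_H : R -> R) N x].
  by move=> l; apply: sweep => //; rewrite invr_gt0 mulr_gt0 // exprn_gt0.
have mH l : measurable (H l) by have [] := HW l.
have mW l : measurable (W l) by have [] := HW l.
pose u l (x : measurableTypeR R) : \bar R := (2 ^+ l * \1_(H l) x)%:E.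
have u0 l x : (0 <= u l x)%E by rewrite lee_fin mulr_ge0 // exprn_ge0.
have mu_ l : measurable_fun I01 (u l).
  by apply/measurable_EFinP; apply: measurable_funM => //; exact: measurable_indic.
pose fe (x : measurableTypeR R) : \bar R := (\sum_(0 <= l <oo) u l x)%E.
have fe0 x : (0 <= fe x)%E by apply: nneseries_ge0.
have mfe : measurable_fun I01 fe by apply: ge0_emeasurable_sum.
have intfe : (\int[mu]_(x in I01) fe x < +oo)%E.
  rewrite integral_nneseries //.
  apply: (@le_lt_trans _ _ (\sum_(0 <= l <oo) (0 + (2 / (2 ^ l.+1)%:R)%:E))%E); last first.
    apply: (@le_lt_trans _ _ (\sum_(0 <= l <oo) 0 + 2%:E)%E).
      exact: epsilon_trick.
    by rewrite eseries0 ?add0e ?ltry.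
  apply: lee_nneseries => [l _ _|l _]; first exact: integral_ge0.
  rewrite /u; under eq_integral do rewrite EFinM.
  have h1 : measurable_fun I01 (fun x : measurableTypeR R => (\1_(H l) x : R)%:E).
    by apply/measurable_EFinP; exact: measurable_indic.
  have p2 : 0 <= 2 ^+ l :> R by rewrite exprn_ge0.
  rewrite ge0_integralZl_EFin //.
  rewrite integral_indic // add0e setIC.
  have [_ _ hH _ _] := HW l.
  apply: (@le_trans _ _ ((2 ^+ l)%:E * ((2 ^+ l * 2 ^+ l)^-1)%:E)%E).
    by apply: lee_wpmul2l => //; rewrite lee_fin exprn_ge0.
  rewrite -EFinM lee_fin natrX exprS.
  have t0 : 2 ^+ l != 0 :> R by rewrite expf_neq0.
  by rewrite (_ : 2 / (2 * 2 ^+ l) = 2 ^+ l * (2 ^+ l * 2 ^+ l)^-1 :> R) //; field.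
have ife : mu.-integrable I01 fe.
  apply/integrableP; split=> //.
  by under eq_integral do rewrite gee0_abs //.
pose f (x : R) : R := fine (fe x).
have intf : mu.-integrable I01 (EFin \o f).
  have mf : measurable_fun I01 (EFin \o f).
    apply/measurable_EFinP.
    exact: (measurableT_comp (fine_measurable measurableT) mfe).
  apply/integrableP; split=> //; apply: le_lt_trans intfe.
  apply: ge0_le_integral => //; first exact: measurableT_comp.
  move=> x _; rewrite /f /=; have := fe0 x; case: (fe x) => [r| |] //= r0.
    by rewrite ger0_norm.
  by rewrite normr0 leey.
have [A [mA A0 HA]] := integrable_ae measurable_I01 ife.
have [N1 [mN1 N10 HN1]] := conv f intf.
pose V := lim_sup_set (fun l => I01 `&` W l).
have mIW l : measurable (I01 `&` W l) by apply: measurableI.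
have mV : measurable V.
  by apply: bigcap_measurable => // k _; apply: bigcup_measurable.
have V2 : ((2^-1)%:E <= mu V)%E.
  have := lim_sup_set_cvg mu (fun l => I01 `&` W l) mIW.
  have fin : (mu (\bigcup_(k in [set k | (0 <= k)%N]) (I01 `&` W k)) < +oo)%E.
    apply: (@le_lt_trans _ _ (mu I01)); last by rewrite mu_I01 ltry.
    rewrite le_measure ?inE //; first exact: bigcup_measurable.
    by move=> x [k _ []].
  move=> /(_ fin) cv; rewrite -(cvg_lim _ cv) //; apply: lime_ge.
    by apply/cvg_ex; eexists; exact: cv.
  apply: nearW => n; have [_ _ _ hW _] := HW n; apply: le_trans hW _.
  rewrite le_measure ?inE //; first exact: bigcup_measurable.
  by move=> x Wx; exists n => //=.
pose B n : setR := I01 `&` dil n.+1 @^-1` A.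
have mB n : measurable (B n).
  by apply: measurableI => //; exact: measurable_dil_preimage.
have B0 n : mu (B n) = 0%E.
  rewrite /B measure_dil //; apply/eqP; rewrite eq_le measure_ge0 andbT -A0.
  by rewrite le_measure ?inE //; exact: measurableI.
have Vsub : V `<=` N1 `|` \bigcup_n B n.
  move=> x Vx; apply: contrapT => nx.
  have xI : I01 x by have [j _ []] := Vx 0%N I.
  have xN1 : ~ N1 x by move=> h; apply: nx; left.
  have xB n : ~ B n x by move=> h; apply: nx; right; exists n.
  have cv : cvgn (fun N => dil_avg S f N x).
    by apply: contrapT => h; apply: xN1; apply: HN1 => /(_ xI).
  have [M [_ HM]] := cvg_seq_bounded cv.
  pose M1 := `|M| + 1.
  have bd N : dil_avg S f N x <= M1.
    apply: le_trans (ler_norm _) _; apply: (HM M1) => //.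
    by rewrite /M1; have := ler_norm M; lra.
  pose l := Num.truncn (2 * M1).
  have [j /= lj [_ Wx]] := Vx l I.
  have [_ _ _ _ /(_ x Wx)[N HN]] := HW j.
  have lM : 2 * M1 < 2 ^+ j.
    have M10 : 0 <= 2 * M1 by rewrite mulr_ge0 // addr_ge0.
    have /andP[_ h] := truncn_itv M10; apply: (lt_le_trans h).
    rewrite -natrX ler_nat; apply: leq_trans (_ : 2 ^ l <= _)%N.
      by rewrite ltn_expl.
    by rewrite leq_exp2l.
  have big : 2 ^+ j * dil_avg S (\1_(H j) : R -> R) N x <= dil_avg S f N x.
    rewrite -dil_avgZ !dil_avgE ler_wpM2r ?invr_ge0 //.
    rewrite big_seq [leRHS]big_seq; apply: ler_sum => n nS.
    have n0 := trunc_set_gt0 Ssg nS.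
    have finy : fe (dil n x) \is a fin_num.
      apply: contrapT => h; apply: (xB n.-1); split=> //.
      rewrite /preimage /= prednK //; apply: HA => /(_ (dil_I01 n x)); exact: h.
    rewrite -lee_fin /f fineK //.
    have := @nneseries_lim_ge R (fun l => u l (dil n x)) xpredT 0%N j.+1
      (fun l _ _ => u0 l _).
    apply: le_trans; rewrite big_nat_recr //= leeDr //.
    by apply: sume_ge0 => i _; exact: u0.
  have p0 : 0 < 2 ^+ j :> R by rewrite exprn_gt0.
  have := bd N; have : 2 ^+ j * 2^-1 <= dil_avg S f N x.
    by apply: le_trans big; rewrite ler_wpM2l // ltW.
  by move: lM; lra.
have mN : measurable (N1 `|` \bigcup_n B n).
  by apply: measurableU => //; exact: bigcup_measurable.
have N0 : mu (N1 `|` \bigcup_n B n) = 0%E.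
  apply/negligibleP => //; apply: negligibleU; first exact/negligibleP.
  by apply: negligible_bigcup => k; exact: (negligibleP mu (mB k)).2 (B0 k).
have : (mu V <= 0)%E by rewrite -N0 le_measure ?inE.
move=> /(le_trans V2); rewrite lee_fin invr_le0; lra.
Qed.

End negative.

Lemma smallest_mul_closed G : mul_closed (smallest mul_closed G).
Proof.
move=> m n hm hn A AMG; apply: AMG.1; [exact: hm|exact: hn].
Qed.

(** A positive integer whose prime factors are at most B is a product of
    elements of {1, ..., B+1}; the bound B+1 instead of B keeps 1 among the
    generators when B = 0. *)
Lemma finitely_generated_primes S : pos_semigroup S ->
  (exists T : set nat, [/\ pos_semigroup T, finitely_generated T & S `<=` T]) <->
  exists B, primes_le S B.
Proof.
move=> [Spos SM]; split.
  move=> [T [[Tpos _] [G Gfin TE] ST]].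
  pose B := (\max_(n <- fset_set G) n)%N; exists B => n p Sn pp pn.
  have : T n by exact: ST.
  rewrite TE => /(_ [set m : nat | forall p, prime p -> (p %| m)%N -> (p <= B)%N]).
  apply=> //; split.
    move=> a b ha hb r pr /=; rewrite Euclid_dvdM // => /orP[/ha|/hb]; exact.
  move=> g Gg r pr rg.
  have g0 : (0 < g)%N by apply: Tpos; rewrite TE => A [_]; exact.
  apply: leq_trans (dvdn_leq g0 rg) _.
  apply: (@leq_bigmax_seq _ _ xpredT (fun m : nat => m) g) => //.
  by rewrite in_fset_set // mem_set.
move=> [B SB].
pose G := [set n : nat | (0 < n <= B.+1)%N].
exists (smallest mul_closed G); split.
- split; last exact: smallest_mul_closed.
  move=> n /(_ [set n | (0 < n)%N]); apply; split.
    by move=> a b /= a0 b0; rewrite muln_gt0 a0.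
  by move=> a /= /andP[].
- exists G => //; apply: (@sub_finite_set _ _ `I_B.+2); last exact: finite_II.
  by move=> n /= /andP[_]; rewrite ltnS.
suff H n : (0 < n)%N -> (forall p, prime p -> (p %| n)%N -> (p <= B)%N) ->
    smallest mul_closed G n.
  by move=> n Sn; apply: H => [|p pp]; [exact: Spos|exact: SB].
have [k] := ubnP n; elim: k => // k IH in n *; rewrite ltnS => nk n0 nB.
have [n1|n1] := leqP n 1.
  by move=> A [_]; apply; rewrite /G /= n0 (leq_trans n1).
have pp := pdiv_prime n1; have pn := pdiv_dvd n.
rewrite -(divnK pn); apply: smallest_mul_closed.
  apply: IH.
  - by apply: leq_trans nk; rewrite ltn_Pdiv // prime_gt1.
  - by rewrite divn_gt0 ?prime_gt0 // dvdn_leq.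
  - by move=> p pp' pd; apply: nB => //; rewrite -(divnK pn) dvdn_mulr.
by move=> A [_]; apply; rewrite /G /= prime_gt0 //= ltnW // ltnS nB.
Qed.

Theorem theorem5p7 (R : realType) (S : set nat)
  (S_semigroup : pos_semigroup S) (S_infinite : infinite_set S) :
  (forall f : R -> R,
     (@lebesgue_measure R).-integrable `[0, 1[ (EFin \o f) ->
     {ae (@lebesgue_measure R), forall x : R, `[0, 1[%classic x ->
        dil_avg S f N x @[N --> \oo] -->
          \int[@lebesgue_measure R]_(y in `[0, 1[) f y})
  <->
  (exists T : set nat,
     [/\ pos_semigroup T, finitely_generated T & S `<=` T]).
Proof.
rewrite finitely_generated_primes //; split=> [conv|[B SB] f intf]; last first.
  exact: (positive_direction S_semigroup S_infinite SB).
apply: contrapT => nB; apply: (@negative_direction R S S_semigroup).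
  move=> B; apply: contrapT => H; apply: nB; exists B => n p Sn pp pn.
  by rewrite leqNgt; apply/negP => Bp; apply: H; exists n, p.
move=> f intf; apply: negligibleS (conv f intf) => x /= nx cv; apply: nx => xI.
by apply/cvg_ex; eexists; exact: cv.
Qed.
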